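(* Let $F:\mathbb{R}^n\rightrightarrows\mathbb{R}^n$ be a multifunction with Hamiltonian $H$ satisfying hypotheses (F1), (F2), (H1), (H2) of the context. Let $\mathcal{S}\subset\mathbb{R}^n$ be nonempty, closed, and have the inner ball property of radius $\rho_0$ for some $\rho_0>0$. Let $T(\cdot)$ be the minimum time function to reach $\mathcal{S}$ for $\dot x\in F(x)$, let $\mathcal{C}=\{x\in\mathbb{R}^n\setminus\mathcal{S} : T(x)<+\infty\}$, and suppose $T(\cdot)$ is continuous in an open subset $\mathcal{O}$ of $\mathcal{C}$. Then there exists a continuous function $\rho_T(\cdot):\mathcal{O}\to(0,\infty)$ such that the hypograph of the restriction $T_{|\mathcal{O}}$ satisfies the $\rho_T(\cdot)$-exterior sphere condition.
   Context: Let $H(x,p)=\sup_{v\in F(x)}\langle v,p\rangle$ for $(x,p)\in\mathbb{R}^n\times\mathbb{R}^n$. The hypotheses are: (F1) $F(x)$ is nonempty, convex and compact for each $x\in\mathbb{R}^n$. (F2) $F$ is Lipschitz continuous on $\mathbb{R}^n$ with respect to the Hausdorff distance. (H1) There is a constant $c_0\ge 0$ such that, for every $p$, $x\mapsto H(x,p)$ is semiconvex on $\mathbb{R}^n$ with constant $c_0|p|$, i.e. $H((1-\lambda)x_0+\lambda x_1,p)-(1-\lambda)H(x_0,p)-\lambda H(x_1,p)\le c_0|p|\lambda(1-\lambda)|x_1-x_0|^2$ for all $x_0,x_1\in\mathbb{R}^n$, $\lambda\in[0,1]$. (H2) For all $p\ne0$ and all $x$, the gradient $\nabla_pH(x,p)$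 exists, and there is $K_1\ge0$ with $|\nabla_pH(x,p)-\nabla_pH(y,p)|\le K_1|y-x|$ for all $x,y\in\mathbb{R}^n$ and $p\neq0$. A trajectory from $x_0$ is an absolutely continuous $y:[0,\infty)\to\mathbb{R}^n$ with $y(0)=x_0$ and $\dot y(t)\in F(y(t))$ for a.e. $t\ge0$. Its transition time is $\theta(y)=\inf\{t\ge0 : y(t)\in\mathcal{S}\}\in[0,\infty]$, and $T(x_0)=\inf\{\theta(y) : y \text{ is a trajectory from } x_0\}\in[0,\infty]$. For a set $Q\subset\mathbb{R}^m$ and $x\in Q$, a vector $v\in\mathbb{R}^m$ is a proximal normal to $Q$ at $x$ (written $v\in N^P_Q(x)$) if there is $\sigma\ge0$ with $\langle v,y-x\rangle\le\sigma|y-x|^2$ for all $y\in Q$; it is realized by a ball of radius $\rho>0$ if this holds with $\sigma=\frac{|v|}{2\rho}$. A closed set $Q\subset\mathbb{R}^n$ has the inner ball property of radius $\rho_0$ if, with $Q'$ the closure of $\mathbb{R}^n\setminus Q$, for every $x\in\partial Q$ there is a nonzero $v\in N^P_{Q'}(x)$ realized by a ball of radius $\rho_0$. For $f:\Omega\to\mathbb{R}$ with $\Omega\subset\mathbb{R}^n$ open, $\mathrm{hypo}(f)=\{(x,\beta) : x\in\Omega,\ \beta\le f(x)\}\subset\mathbb{R}^{n+1}$. Given a continuous $\theta:\Omega\to(0,\infty)$, $\mathrm{hypo}(f)$ satisfies the $\theta(\cdot)$-exterior sphere condition if for every $x\in\Omega$ there is a nonzero vector $v_x\in N^P_{\mathrm{hypo}(f)}(x,f(x))$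 realized by a ball in $\mathbb{R}^{n+1}$ of radius $\theta(x)$. *)

(* Defs.v *)
From HB Require Import structures.
From mathcomp Require Import all_boot all_order all_algebra.
From mathcomp Require Import all_classical all_reals all_analysis.

Set Implicit Arguments.
Unset Strict Implicit.
Unset Printing Implicit Defensive.

Import Order.TTheory GRing.Theory Num.Theory.
Import numFieldNormedType.Exports.

Local Open Scope classical_set_scope.
Local Open Scope ring_scope.

Section Euclidean.
Context {R : realType}.

Definition dot n (u v : 'rV[R]_n) : R := (u *m v^T) 0 0.

(* The library's norm on row vectors is the sup norm. It induces the same
   topology, so closure, compactness, continuity and differentiability below
   are the library's, but all metric quantities use the Euclidean norm. *)
Definition enorm n (u : 'rV[R]_n) : R := Num.sqrt (dot u u).

Definition boundary n (Q : set 'rV[R]_n) : set 'rV[R]_n :=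
  closure Q `\` interior Q.

Definition dist_to n (a : 'rV[R]_n) (B : set 'rV[R]_n) : \bar R :=
  ereal_inf [set (enorm (a - b))%:E | b in B].

Definition hausdorff_dist n (A B : set 'rV[R]_n) : \bar R :=
  maxe (ereal_sup [set dist_to a B | a in A])
       (ereal_sup [set dist_to b A | b in B]).

Definition gradient n (f : 'rV[R]_n -> R) (p : 'rV[R]_n) : 'rV[R]_n :=
  \row_i 'D_(delta_mx 0 i) f p.

Definition semiconvex n (c : R) (f : 'rV[R]_n -> R) : Prop :=
  forall (x0 x1 : 'rV[R]_n) (l : R), 0 <= l <= 1 ->
    f ((1 - l) *: x0 + l *: x1) - (1 - l) * f x0 - l * f x1
      <= c * l * (1 - l) * enorm (x1 - x0) ^+ 2.

Definition abs_continuous n (a b : R) (y : R -> 'rV[R]_n) : Prop :=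
  forall e : R, 0 < e -> exists2 d : R, 0 < d &
    forall (k : nat) (s t : 'I_k -> R),
      (forall i, [/\ a <= s i, s i <= t i & t i <= b]) ->
      trivIset setT (fun i => [set` `]s i, t i[%R]) ->
      \sum_(i < k) (t i - s i) < d ->
      \sum_(i < k) enorm (y (t i) - y (s i)) < e.

End Euclidean.

Section DifferentialInclusion.
Context {R : realType} {n : nat}.
Variable F : 'rV[R]_n -> set 'rV[R]_n.

Definition hamiltonian (x p : 'rV[R]_n) : R := sup [set dot v p | v in F x].

Definition F1 : Prop :=
  forall x, [/\ F x !=set0, convex_set (F x) & compact (F x)].

Definition F2 : Prop :=
  exists2 L : R, 0 <= L &
    forall x y, (hausdorff_dist (F x) (F y) <= (L * enorm (x - y))%:E)%E.

Definition H1 : Prop :=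
  exists2 c0 : R, 0 <= c0 &
    forall p, semiconvex (c0 * enorm p) (fun x => hamiltonian x p).

Definition H2 : Prop :=
  (forall x p, p != 0 -> differentiable (hamiltonian x) p) /\
  exists2 K1 : R, 0 <= K1 &
    forall x y p, p != 0 ->
      enorm (gradient (hamiltonian x) p - gradient (hamiltonian y) p)
        <= K1 * enorm (y - x).

(* Only the values of y on [0, +oo[ matter. Absolute continuity on the
   half-line means absolute continuity on each compact subinterval, since
   trajectories may grow exponentially. *)
Definition trajectory (x0 : 'rV[R]_n) (y : R -> 'rV[R]_n) : Prop :=
  [/\ y 0 = x0,
      forall b : R, 0 <= b -> abs_continuous 0 b y &
      {ae (@lebesgue_measure R), forall t : R,
        0 <= t -> derivable y t 1 /\ F (y t) (derive1 y t)}].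

Variable S : set 'rV[R]_n.

Definition transition_time (y : R -> 'rV[R]_n) : \bar R :=
  ereal_inf [set t%:E | t in [set t : R | 0 <= t /\ S (y t)]].

Definition minimum_time (x0 : 'rV[R]_n) : \bar R :=
  ereal_inf [set transition_time y | y in trajectory x0].

Definition controllable_set : set 'rV[R]_n :=
  [set x | ~ S x /\ (minimum_time x < +oo)%E].

End DifferentialInclusion.

Section ProximalNormals.
Context {R : realType}.

Definition proximal_ineq m (Q : set 'rV[R]_m) (x v : 'rV[R]_m) (sigma : R) :
    Prop :=
  forall y, Q y -> dot v (y - x) <= sigma * enorm (y - x) ^+ 2.

Definition proximal_normal m (Q : set 'rV[R]_m) (x v : 'rV[R]_m) : Prop :=
  exists2 sigma : R, 0 <= sigma & proximal_ineq Q x v sigma.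

Definition realized_by_ball m (Q : set 'rV[R]_m) (x v : 'rV[R]_m) (rho : R) :
    Prop :=
  proximal_ineq Q x v (enorm v / (2 * rho)).

Definition inner_ball_property m (Q : set 'rV[R]_m) (rho0 : R) : Prop :=
  let Q' := closure (~` Q) in
  forall x, boundary Q x ->
    exists v, [/\ v != 0, proximal_normal Q' x v & realized_by_ball Q' x v rho0].

Definition graph_point n (x : 'rV[R]_n) (b : R) : 'rV[R]_(n + 1) :=
  row_mx x b%:M.

Definition hypo n (Om : set 'rV[R]_n) (f : 'rV[R]_n -> R) :
    set 'rV[R]_(n + 1) :=
  [set z | exists x b, [/\ Om x, b <= f x & z = graph_point x b]].

Definition exterior_sphere n (Om : set 'rV[R]_n) (f theta : 'rV[R]_n -> R) :
    Prop :=
  forall x, Om x ->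
    exists v, [/\ v != 0,
      proximal_normal (hypo Om f) (graph_point x (f x)) v &
      realized_by_ball (hypo Om f) (graph_point x (f x)) v (theta x)].

End ProximalNormals.

(* Main.v *)
Require Import Defs.
From HB Require Import structures.
From mathcomp Require Import all_boot all_order all_algebra.
From mathcomp Require Import all_classical all_reals all_analysis.
From mathcomp Require Import ring lra.

Set Implicit Arguments.
Unset Strict Implicit.
Unset Printing Implicit Defensive.

Import Order.TTheory GRing.Theory Num.Theory.
Import numFieldNormedType.Exports.

Local Open Scope classical_set_scope.
Local Open Scope ring_scope.

(** The normal at the hypograph point over [x] is a limit of adjoint vectors
    of time-discretised optimal control problems.

    Take an almost optimal trajectory from [x]. Where it enters the target,
    the inner ball property provides a ball of radius [rho0] inside the
    target, with centre [c], touched by the trajectory. Replace the inclusion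
    by its Euler discretisation and minimise the distance to [c] after [k]
    steps. The optimal distance is a Bellman function, and it is semiconcave
    along an optimal arc ([discrete_semiconcavity]): going backwards, the
    adjoint vector [p] is updated with a subgradient of the semiconvex
    function [H ^~ p], the maximum principle is the first-order condition of
    the Bellman minimisation, and by (H2) the maximising velocity is a
    Lipschitz function of the state, so the same momenta steer nearby points
    [z] with an error of second order. The final time is a variable on the
    same footing as the state, because the size of the steps may vary with
    their number fixed. This yields a pair [(p, q)] with
      |arc from z at time b - c| <= rho0 - p.(z - x) - q (b - theta)
        + C (|z - x|^2 + (b - theta)^2) + small,
    where [p] is bounded away from [0] and all constants depend on bounds of
    [|x|] and of the minimum time only.

    The left-hand side is compared with [rho0]. The arcs steered by fixed
    momenta are shadowed by genuine trajectories, since a Lipschitz feedback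
    has solutions ([lipschitz_ode], [euler_arc_tracking]); a trajectory from
    [z] is outside the target before the minimum time, so if [b <= T z] the
    left-hand side is at least [rho0], up to the step size. The almost optimal
    trajectory itself is followed by discrete arcs ([value_tracking]) thanks
    to a mean value inequality for absolutely continuous functions
    ([ac_mean_value]). These two facts give [approximate_normal].

    Finally the step size tends to [0] along an ultrafilter ([exact_normal]).
    The inequality above becomes the proximal inequality for the hypograph at
    [(x, theta)], with [theta <= T x]. As [p] is nonzero this point is not
    interior, and since [T] is continuous near [x] this forces [theta = T x].
    The radius is an explicit continuous function of [|x| + T x]. *)

(** * Euclidean geometry and limits of bounded sequences *)

Section EuclideanBasics.
Context {R : realType} {n : nat}.
Implicit Types u v w : 'rV[R]_n.

Lemma dotE u v : dot u v = \sum_i u 0 i * v 0 i.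
Proof. by rewrite /dot mxE; apply: eq_bigr => i _; rewrite mxE. Qed.

Lemma dotC u v : dot u v = dot v u.
Proof. by rewrite !dotE; apply: eq_bigr => i _; rewrite mulrC. Qed.

Lemma dotDl u v w : dot (u + v) w = dot u w + dot v w.
Proof. by rewrite /dot mulmxDl mxE. Qed.

Lemma dotZl a u v : dot (a *: u) v = a * dot u v.
Proof. by rewrite /dot -scalemxAl mxE. Qed.

Lemma dotDr u v w : dot u (v + w) = dot u v + dot u w.
Proof. by rewrite dotC dotDl !(dotC u). Qed.

Lemma dotZr a u v : dot u (a *: v) = a * dot u v.
Proof. by rewrite dotC dotZl dotC. Qed.

Lemma dotNl u v : dot (- u) v = - dot u v.
Proof. by rewrite -scaleN1r dotZl mulN1r. Qed.

Lemma dotNr u v : dot u (- v) = - dot u v.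
Proof. by rewrite dotC dotNl dotC. Qed.

Lemma dotBl u v w : dot (u - v) w = dot u w - dot v w.
Proof. by rewrite dotDl dotNl. Qed.

Lemma dotBr u v w : dot u (v - w) = dot u v - dot u w.
Proof. by rewrite dotDr dotNr. Qed.

Lemma dot0l u : dot 0 u = 0.
Proof. by rewrite -(scale0r u) dotZl mul0r. Qed.

Lemma dot0r u : dot u 0 = 0.
Proof. by rewrite dotC dot0l. Qed.

Lemma dot_ge0 u : 0 <= dot u u.
Proof. by rewrite dotE sumr_ge0// => i _; rewrite -expr2 sqr_ge0. Qed.

Lemma enorm_ge0 u : 0 <= enorm u.
Proof. exact: sqrtr_ge0. Qed.

Lemma enorm_sqr u : enorm u ^+ 2 = dot u u.
Proof. by rewrite sqr_sqrtr ?dot_ge0. Qed.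

Lemma coord_le_enorm u i : `|u 0 i| <= enorm u.
Proof.
rewrite -sqrtr_sqr ler_wsqrtr// dotE (bigD1 i)//= -expr2 lerDl.
by rewrite sumr_ge0// => j _; rewrite -expr2 sqr_ge0.
Qed.

Lemma enorm0 : enorm (0 : 'rV[R]_n) = 0.
Proof. by rewrite /enorm dot0l sqrtr0. Qed.

Lemma enorm0_eq0 u : enorm u = 0 -> u = 0.
Proof.
move=> u0; apply/rowP => i; rewrite mxE; apply/eqP.
by rewrite -normr_le0 (le_trans (coord_le_enorm u i))// u0.
Qed.

Lemma enorm_gt0 u : (0 < enorm u) = (u != 0).
Proof.
rewrite lt_neqAle enorm_ge0 andbT eq_sym; apply/idP/idP; apply: contra => /eqP.
  by move=> ->; rewrite enorm0.
by move=> /enorm0_eq0 ->.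
Qed.

Lemma enormZ a u : enorm (a *: u) = `|a| * enorm u.
Proof.
by rewrite /enorm dotZl dotZr mulrA -expr2 sqrtrM ?sqr_ge0// sqrtr_sqr.
Qed.

Lemma enormN u : enorm (- u) = enorm u.
Proof. by rewrite -scaleN1r enormZ normrN1 mul1r. Qed.

Lemma enormBC u v : enorm (u - v) = enorm (v - u).
Proof. by rewrite -enormN opprB. Qed.

Lemma dot_le u v : dot u v <= enorm u * enorm v.
Proof.
have [->|u0] := eqVneq u 0; first by rewrite dot0l enorm0 mul0r.
have [->|v0] := eqVneq v 0; first by rewrite dot0r enorm0 mulr0.
move: u0 v0; rewrite -!enorm_gt0 => u0 v0.
have := dot_ge0 (enorm v *: u - enorm u *: v).
rewrite !(dotBl, dotBr, dotZl, dotZr) -!enorm_sqr (dotC v u).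
set a := enorm u in u0 *; set b := enorm v in v0 *; set d := dot u v => h.
have : 0 <= 2 * (a * b) * (a * b - d) 
  by rewrite (le_trans h)// le_eqVlt; apply/orP; left; apply/eqP; ring.
by rewrite pmulr_rge0 ?mulr_gt0// subr_ge0.
Qed.

Lemma norm_dot_le u v : `|dot u v| <= enorm u * enorm v.
Proof. by rewrite ler_norml dot_le andbT lerNl -dotNl -(enormN u) dot_le. Qed.

Lemma enormD u v : enorm (u + v) <= enorm u + enorm v.
Proof.
rewrite -(@ler_pXn2r _ 2)// ?nnegrE ?addr_ge0 ?enorm_ge0//.
rewrite sqrrD !enorm_sqr dotDl !dotDr (dotC v u).
have := dot_le u v; lra.
Qed.

Lemma enormB u v : enorm (u - v) <= enorm u + enorm v.
Proof. by rewrite -(enormN v) enormD. Qed.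

Lemma enorm_triangle w u v : enorm (u - v) <= enorm (u - w) + enorm (w - v).
Proof. by rewrite (le_trans _ (enormD _ _))// addrA subrK. Qed.

Lemma enormDB u v : enorm u <= enorm v + enorm (u - v).
Proof. by rewrite (le_trans _ (enormD _ _))// addrC subrK. Qed.

Lemma enorm_sqrB u v :
  enorm (u - v) ^+ 2 = enorm u ^+ 2 - 2 * dot u v + enorm v ^+ 2.
Proof. rewrite !enorm_sqr !(dotBl, dotBr) (dotC v u); ring. Qed.

Lemma enorm_sqrD u v :
  enorm (u + v) ^+ 2 = enorm u ^+ 2 + 2 * dot u v + enorm v ^+ 2.
Proof. rewrite !enorm_sqr !(dotDl, dotDr) (dotC v u); ring. Qed.

(** The library topology on row vectors comes from the sup norm; this comparison
    and [dot_cvg] are what transfers it to the Euclidean norm. *)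
Lemma norm_le_enorm u : `|u| <= enorm u.
Proof.
rewrite [leLHS]mx_normrE; apply/bigmax_leP; split; first exact: enorm_ge0.
by move=> -[i j] _ /=; rewrite (ord1 i) coord_le_enorm.
Qed.

Lemma dot_cvg T (G : set_system T) {FG : Filter G} (f g : T -> 'rV[R]_n) u v :
  f @ G --> u -> g @ G --> v -> (fun t => dot (f t) (g t)) @ G --> dot u v.
Proof.
move=> fu gv; rewrite dotE.
rewrite (_ : (fun t => _) = fun t => \sum_i f t 0 i * g t 0 i); last first.
  by apply/funext => t; rewrite dotE.
apply: (@cvg_big R 'I_n +%R 0 xpredT (@add_continuous R) T G _
  (fun i t => f t 0 i * g t 0 i) (fun i => u 0 i * v 0 i) FG) => i _.
apply: cvgM; first exact: (cvg_comp _ _ fu (@coord_continuous _ _ _ 0 i u)).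
exact: (cvg_comp _ _ gv (@coord_continuous _ _ _ 0 i v)).
Qed.

Lemma enorm_cvg T (G : set_system T) {FG : Filter G} (f : T -> 'rV[R]_n) u :
  f @ G --> u -> (fun t => enorm (f t)) @ G --> enorm u.
Proof.
move=> fu; have ff := @dot_cvg T G FG f f u u fu fu.
exact: (cvg_comp _ _ ff (@sqrt_continuous R (dot u u))).
Qed.

Lemma cvg_enormP T (G : set_system T) {FG : Filter G} (f : T -> 'rV[R]_n) u :
  f @ G --> u <-> forall e, 0 < e -> \forall t \near G, enorm (f t - u) < e.
Proof.
split=> [fu e e0|h].
  have : (fun t => enorm (f t - u)) @ G --> (0 : R).
    rewrite -enorm0 -(subrr u); apply: enorm_cvg; apply: cvgB => //; exact: cvg_cst.
  move=> /cvgrPdist_lt/(_ e e0); apply: filterS => t.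
  by rewrite sub0r normrN ger0_norm ?enorm_ge0.
apply/cvgrPdist_lt => e /h; apply: filterS => t.
by rewrite distrC; exact: le_lt_trans (norm_le_enorm _).
Qed.

Lemma near_enorm_lt u e : 0 < e -> \forall v \near u, enorm (v - u) < e.
Proof.
have uu : id @ u --> u by exact: cvg_id.
by move: e; apply: (cvg_enormP (FG := nbhs_filter u) id u).1.
Qed.

Lemma enorm_ball_compact (r : R) : compact [set u : 'rV[R]_n | enorm u <= r].
Proof.
apply: bounded_closed_compact.
  exists r; split; first exact: num_real.
  move=> x rx u /= ur; apply: le_trans (norm_le_enorm _) _.
  by rewrite (le_trans ur)// ltW.
have -> : [set u : 'rV[R]_n | enorm u <= r] = @enorm R n @^-1` [set x | x <= r] by [].
apply: closed_comp; last exact: closed_le.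
by move=> u _; exact: (enorm_cvg (FG := nbhs_filter u) cvg_id).
Qed.

Lemma compact_enorm_bounded (A : set 'rV[R]_n) : compact A ->
  exists2 b : R, 0 <= b & forall u, A u -> enorm u <= b.
Proof.
move=> cA; have [->|/set0P A0] := eqVneq A set0; first by exists 0.
have [|c cA' h] := compact_EVT_max (f := @enorm R n) A0 cA.
  apply: continuous_subspaceT => u; exact: (enorm_cvg (FG := nbhs_filter u) cvg_id).
exists (enorm c); first exact: enorm_ge0.
by move=> u Au; apply: h; rewrite inE.
Qed.

Lemma ultra_fmap T T' (f : T -> T') (U : set_system T) :
  UltraFilter U -> UltraFilter (f @ U).
Proof.
move=> UU; have PU : ProperFilter U by exact: ultra_proper.
split; first exact: fmap_proper_filter.
move=> G PG sUG; apply/seteqP; split=> // A GA; rewrite /= /fmap/=.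
have [//|UnA] := in_ultra_setVsetC (f @^-1` A) UU.
have : G (~` A) by apply: sUG.
by move=> /(filterI GA); rewrite setICr => /filter_ex[].
Qed.

(** An ultrafilter limit attaches to all bounded sequences at once a limit
    along the same filter, which replaces diagonal extractions. *)
Lemma ultra_bounded_cvg (U : set_system nat) (f : nat -> 'rV[R]_n) b :
  UltraFilter U -> (forall m, enorm (f m) <= b) -> cvg (f @ U).
Proof.
move=> UU fb; have PU : ProperFilter U by exact: ultra_proper.
have := @enorm_ball_compact b.
rewrite compact_ultra => /(_ (f @ U)) [].
- exact: ultra_fmap.
- by apply: (@filterE _ U) => m /=; exact: fb.
- by move=> u [_ fu]; apply/cvg_ex; exists u.
Qed.

End EuclideanBasics.

Lemma nat_ultrafilter : exists2 U : set_system nat, UltraFilter U & \oo `<=` U.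
Proof.
by have [U [UU sU]] := ultraFilterLemma (eventually_filter); exists U.
Qed.

Lemma ultra_bounded_cvgR (R : realType) (U : set_system nat) (f : nat -> R) b :
  UltraFilter U -> (forall m, `|f m| <= b) -> cvg (f @ U).
Proof.
move=> UU fb; have PU : ProperFilter U by exact: ultra_proper.
have := @segment_compact R (- b) b.
rewrite compact_ultra => /(_ (f @ U)) [].
- exact: ultra_fmap.
- by apply: (@filterE _ U) => m; rewrite /= in_itv/= -ler_norml; exact: fb.
- by move=> u [_ fu]; apply/cvg_ex; exists u.
Qed.

Lemma filter_le_cvg (R : realType) (U : set_system nat) (f g : nat -> R) a b :
  ProperFilter U -> f @ U --> a -> g @ U --> b -> (forall m, f m <= g m) ->
  a <= b.
Proof.
move=> PU fa gb fg; apply: (ler_cvg_to fa gb).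
by apply: (@filterE _ U) => m; exact: fg.
Qed.

(** * The Hamiltonian of a Lipschitz compact-valued multifunction *)

(** The difference quotient form of derivability, with the singular [h = 0] of
    the punctured neighbourhood absorbed. *)
Lemma derivable_expand (R : realType) (V W : normedModType R) (f : V -> W)
    (x v : V) (e : R) : derivable f x v -> 0 < e ->
  exists2 d : R, 0 < d & forall h, `|h| < d ->
    `|f (h *: v + x) - f x - h *: 'D_v f x| <= e * `|h|.
Proof.
move=> df e0.
have /cvgrPdist_lt/(_ e e0) : (fun h : R => h^-1 *: (f (h *: v + x) - f x)) @ 0^'
  --> 'D_v f x by exact: df.
move=> /nbhs_ballP[d/= d0 hd]; exists d => // h hh.
have [->|h0] := eqVneq h 0.
  by rewrite !scale0r add0r !subrr normr0 normr0 mulr0.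
have hb : ball 0 d h by rewrite -ball_normE/= sub0r normrN.
have := hd h hb h0 => /ltW.
rewrite -(@ler_pM2l _ `|h|) ?normr_gt0// -normrZ scalerBr scalerA mulfV//.
by rewrite scale1r distrC mulrC.
Qed.

Section Hamiltonian.
Context {R : realType} {n : nat}.
Variable F : 'rV[R]_n -> set 'rV[R]_n.
Hypothesis hF1 : F1 F.
Local Notation H := (hamiltonian F).
Implicit Types x y p f : 'rV[R]_n.

Lemma hamiltonian_ge x p f : F x f -> dot f p <= H x p.
Proof.
move=> Ff; have [_ _ /compact_enorm_bounded[b b0 hb]] := hF1 x.
apply: ub_le_sup; last by exists f.
exists (b * enorm p) => _ [g Fg <-].
by rewrite (le_trans (dot_le _ _))// ler_wpM2r ?enorm_ge0// hb.
Qed.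

Lemma hamiltonian_le x p M :
  (forall f, F x f -> dot f p <= M) -> H x p <= M.
Proof.
move=> h; have [[f Ff] _ _] := hF1 x.
by apply: ge_sup; [exists (dot f p), f | move=> _ [g Fg <-]; exact: h].
Qed.

Lemma hamiltonian_attained x p : exists2 f, F x f & dot f p = H x p.
Proof.
have [F0 _ cF] := hF1 x.
have [|f Ff h] := compact_EVT_max (f := fun f => dot f p) F0 cF.
  apply: continuous_subspaceT => u.
  exact: (dot_cvg (FG := nbhs_filter u) cvg_id (cvg_cst p)).
exists f; first by rewrite inE in Ff.
apply/eqP; rewrite eq_le hamiltonian_ge ?inE//=; last by rewrite inE in Ff.
by apply: hamiltonian_le => g Fg; apply: h; rewrite inE.
Qed.

Lemma F1_segment x f g (s : R) : F x f -> F x g -> 0 <= s <= 1 ->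
  F x (f + s *: (g - f)).
Proof.
move=> Ff Fg /andP[s0 s1]; have [_ cF _] := hF1 x.
have := cF g f (Itv01 s0 s1); rewrite !inE => /(_ Fg Ff).
rewrite (_ : f + _ = s *: g + (1 - s) *: f)//.
by apply/rowP => i; rewrite !mxE; ring.
Qed.

(** Support functions determine convex compact sets up to distance: at the point
    [f] of [F x] nearest to [u], the direction [u - f] is an outer normal, so the
    hypothesis on it bounds [|u - f|^2] by [d |u - f|]. *)
Lemma support_nearest x u (d : R) : 0 <= d ->
  (forall p, dot u p <= H x p + d * enorm p) ->
  exists2 f, F x f & enorm (u - f) <= d.
Proof.
move=> d0 hu; have [F0 _ cF] := hF1 x.
have [|f Ff h] := compact_EVT_min (f := fun f => enorm (u - f)) F0 cF.
  apply: continuous_subspaceT => w; apply: (enorm_cvg (FG := nbhs_filter w)).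
  apply: cvgB; [exact: cvg_cst|exact: cvg_id].
move: Ff; rewrite inE => Ff; exists f => //.
have opt g : F x g -> dot (g - f) (u - f) <= 0.
  move=> Fg; rewrite leNgt; apply/negP => c0.
  set c := dot _ _ in c0; set a := dot (g - f) (g - f).
  have a0 : 0 <= a by exact: dot_ge0.
  (* with this step the linear gain [2 s c] beats the quadratic cost [s^2 a] *)
  pose s := c / (c + a).
  have ca : 0 < c + a by rewrite ltr_wpDr.
  have s01 : 0 <= s <= 1.
    by rewrite /s divr_ge0 ?(ltW c0) ?(ltW ca)//= ler_pdivrMr// mul1r lerDl.
  have := h (f + s *: (g - f)); rewrite inE => /(_ (F1_segment Ff Fg s01)).
  rewrite -(@ler_pXn2r _ 2)// ?nnegrE ?enorm_ge0// opprD addrA.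
  rewrite (_ : enorm (u - f - s *: (g - f)) ^+ 2 =
    enorm (u - f) ^+ 2 - 2 * (s * c) + s ^+ 2 * a); last first.
    rewrite enorm_sqrB dotZr (dotC (u - f)) -/c enormZ exprMn enorm_sqr.
    by rewrite (enorm_sqr (g - f)) -/a real_normK ?num_real.
  move=> hle.
  have : s * (2 * c - s * a) <= 0 by lra.
  have s0 : 0 < s by rewrite divr_gt0.
  rewrite pmulr_rle0//; apply/negP; rewrite -ltNge.
  have : s * a <= c.
    by rewrite /s mulrAC ler_pdivrMr// mulrDr lerDr mulr_ge0// ltW.
  lra.
have := hu (u - f); have := hamiltonian_le (M := dot f (u - f)).
move=> /(_ x (u - f)) hH hu'.
have {}hH : H x (u - f) <= dot f (u - f).
  by apply: hH => g /opt; rewrite dotBl; lra.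
have : enorm (u - f) ^+ 2 <= d * enorm (u - f).
  by rewrite enorm_sqr dotBl; lra.
have [-> //|/negPf e0] := eqVneq (enorm (u - f)) 0.
by rewrite expr2 ler_pM2r// lt_neqAle enorm_ge0 eq_sym e0.
Qed.

(** A maximiser [f] supports [H x] at [p] by the linear function [dot f], and a
    differentiable function has its gradient as only supporting slope. Hence
    the maximiser is unique. *)
Lemma gradient_hamiltonian x p f : differentiable (H x) p ->
  F x f -> dot f p = H x p -> gradient (H x) p = f.
Proof.
move=> dH Ff fp; apply/rowP => i; rewrite mxE.
set e := delta_mx 0 i.
have dotfe : dot f e = f 0 i.
  rewrite dotE (bigD1 i)//= mxE !eqxx mulr1 big1 ?addr0// => j ji.
  by rewrite mxE (negPf ji) andbF mulr0.
have q h : h * f 0 i <= H x (h *: e + p) - H x p.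
  by rewrite -fp -dotfe -dotZr lerBrDr -dotDr; exact: hamiltonian_ge.
apply/eqP; rewrite -subr_eq0 -normr_le0; apply/ler_addgt0Pl => eps e0.
rewrite addr0.
have [d d0 hd] := derivable_expand (diff_derivable (v := e) dH) e0.
have d2 : `|d / 2| < d by rewrite gtr0_norm ?divr_gt0//; lra.
have d20 : 0 < d / 2 by rewrite divr_gt0.
have := hd _ d2; have := q (d / 2).
have := hd (- (d / 2)); rewrite normrN => /(_ d2); have := q (- (d / 2)).
rewrite (gtr0_norm d20) !ler_norml; set D := 'D_e _ _.
set t := d / 2 in d20 *; rewrite /GRing.scale/=.
move: (H x _) (H x _) => A B q1 /andP[A1 A2] q2 /andP[B1 B2].
by apply/andP; split; rewrite -(ler_pM2l d20); lra.
Qed.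

End Hamiltonian.

(** * Lipschitz dependence and subgradients in the state *)

Section LipschitzInclusion.
Context {R : realType} {n : nat}.
Variable F : 'rV[R]_n -> set 'rV[R]_n.
Hypothesis hF1 : F1 F.
Variable L : R.
Hypothesis L0 : 0 <= L.
Hypothesis hF2 : forall x y,
  (hausdorff_dist (F x) (F y) <= (L * enorm (x - y))%:E)%E.
Local Notation H := (hamiltonian F).
Implicit Types x y p f : 'rV[R]_n.

(** The infimum in the Hausdorff distance yields a point of [F y] only up to an
    arbitrarily small error. *)
Lemma F2_select x y f e : F x f -> 0 < e ->
  exists2 g, F y g & enorm (f - g) <= L * enorm (x - y) + e.
Proof.
move=> Ff e0; have := hF2 x y; rewrite /hausdorff_dist ge_max => /andP[+ _].
have : (dist_to f (F y) <= ereal_sup [set dist_to a (F y) | a in F x])%E.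
  by apply: ereal_sup_ubound; exists f.
move=> /le_trans h /h; rewrite /dist_to.
move=> /(@le_lt_trans _ _ _ _ (L * enorm (x - y) + e)%:E).
rewrite lte_fin ltrDl e0 => /(_ isT) /ereal_inf_lt[_ [g Fg <-]].
by rewrite lte_fin => /ltW; exists g.
Qed.

Lemma hamiltonian_lipschitz x y p :
  H x p - H y p <= L * enorm (x - y) * enorm p.
Proof.
rewrite lerBlDl; apply: (hamiltonian_le hF1) => f Ff.
have p0 := enorm_ge0 p.
apply/ler_addgt0Pl => e e0.
have e'0 : 0 < e / (enorm p + 1) by rewrite divr_gt0// ltr_wpDl.
have [g Fg fg] := F2_select y Ff e'0.
have -> : dot f p = dot g p + dot (f - g) p by rewrite dotBl; ring.
have := hamiltonian_ge hF1 p Fg.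
have := le_trans (dot_le (f - g) p) (ler_wpM2r p0 fg).
have : e / (enorm p + 1) * enorm p <= e.
  by rewrite mulrAC ler_pdivrMr ?ltr_wpDl// ler_pM2l//; lra.
lra.
Qed.

Lemma F_linear_growth : exists2 A : R, L <= A &
  forall x f, F x f -> enorm f <= A * (1 + enorm x).
Proof.
have [_ _ /compact_enorm_bounded[b b0 hb]] := hF1 0.
exists (b + 1 + L) => [|x f Ff]; first by rewrite lerDr addr_ge0.
have [g Fg] := F2_select 0 Ff ltr01; rewrite subr0 => fg.
have := enormDB f g; have := hb _ Fg; have := enorm_ge0 x => x0 gb.
have : 0 <= (b + 1) * enorm x by rewrite mulr_ge0 ?addr_ge0.
move=> h1 h2; move: fg L0 h1 h2 gb.
by move: (enorm _) (enorm _) (enorm _) (enorm _) => *; lra.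
Qed.

(** The vector [zeta] is a limit of the subgradients [2 m (x - z_m)] at the
    minimisers [z_m] of [z |-> h z + m |z - x|^2]: the Lipschitz bound keeps
    [m |z_m - x|] below [l], so these vectors are bounded and [z_m] tends to
    [x]. *)
Lemma semiconvex_subgradient (c l : R) (h : 'rV[R]_n -> R) x :
  semiconvex c h -> 0 <= l -> (forall y z, h y - h z <= l * enorm (y - z)) ->
  exists2 zeta, enorm zeta <= 2 * l &
    forall z, h x + dot zeta (z - x) - c * enorm (z - x) ^+ 2 <= h z.
Proof.
move=> sc l0 hl.
have hcont : continuous h.
  move=> y; apply/(cvgrPdist_le (FF := nbhs_filter y)) => e e0.
  have e'0 : 0 < e / (l + 1) by rewrite divr_gt0// ltr_wpDl.
  have near_y := near_enorm_lt y e'0.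
  apply: (@filterS _ _ (nbhs_filter y) _ _ _ near_y) => z /= yz.
  have B : l * enorm (z - y) <= e.
    rewrite (le_trans (ler_wpM2l l0 (ltW yz)))// mulrA mulrAC ger_pMl//.
    by rewrite ler_pdivrMr ?ltr_wpDl//; lra.
  have := hl y z; have := hl z y; rewrite (enormBC y) => h1 h2.
  by rewrite ler_norml; apply/andP; split; lra.
pose phi m z := h z + m%:R * enorm (z - x) ^+ 2.
have exact_at m : exists z, forall w, phi m.+1 z <= phi m.+1 w.
  (* outside this ball the penalty exceeds any gain the Lipschitz bound allows *)
  pose B := [set z : 'rV[R]_n | enorm z <= enorm x + l].
  have Bx : B x by rewrite /B/= lerDl.
  have [|||z Bz hz] := @compact_EVT_min _ _ (phi m.+1) B.
  - by exists x.
  - exact: enorm_ball_compact.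
  - apply: continuous_subspaceT => y.
    have c1 : (fun z => z - x) @ y --> y - x.
      exact: (cvgB cvg_id (cvg_cst x)).
    have c2 := enorm_cvg (FG := nbhs_filter y) c1.
    have c3 : (fun z => m.+1%:R * enorm (z - x) ^+ 2) @ nbhs y -->
        m.+1%:R * enorm (y - x) ^+ 2.
      by apply: cvgM; [exact: cvg_cst|exact: (cvgM c2 c2)].
    exact: (@cvgD _ _ _ (nbhs y) _ _ _ _ _ (hcont y) c3).
  exists z => w; have [Bw|Bw] := leP (enorm w) (enorm x + l).
    by apply: hz; rewrite inE.
  apply: le_trans (hz x _) _; rewrite ?inE//.
  rewrite /phi subrr enorm0 expr0n mulr0 addr0.
  have lw : l <= enorm (w - x) by have := enormDB w x; lra.
  have := hl x w; rewrite (enormBC x) => hxw.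
  suff : l * enorm (w - x) <= m.+1%:R * enorm (w - x) ^+ 2 by lra.
  have w0 := enorm_ge0 (w - x).
  rewrite expr2 mulrA ler_wpM2r// (le_trans lw)// ler_peMl//.
  by rewrite ler1n.
have [z hz] := boolp.choice exact_at.
pose zeta m := (2 * m.+1%:R) *: (x - z m).
have m0 m : (0 : R) < m.+1%:R by rewrite ltr0n.
have zx m : m.+1%:R * enorm (z m - x) <= l.
  have := hz m x; rewrite /phi subrr enorm0 expr0n mulr0 addr0 => h1.
  have [->|/negPf e0] := eqVneq (enorm (z m - x)) 0; first by rewrite mulr0.
  rewrite -(@ler_pM2r _ (enorm (z m - x))); last first.
    by rewrite lt_neqAle enorm_ge0 eq_sym e0.
  by rewrite -mulrA -expr2; have := hl x (z m); rewrite (enormBC x); lra.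
have zetab m : enorm (zeta m) <= 2 * l.
  rewrite enormZ ger0_norm ?mulr_ge0//.
  rewrite (enormBC x) -mulrA.
  by apply: ler_wpM2l => //; exact: zx.
(* minimality is compared with the points [(1 - s) z_m + s w] for small [s] *)
have sub m w : h (z m) + dot (zeta m) (w - z m) - c * enorm (w - z m) ^+ 2 <= h w.
  set X := _ - c * _; apply/ler_addgt0Pl => e e0.
  set M := m.+1%:R * enorm (w - z m) ^+ 2 - c * enorm (w - z m) ^+ 2.
  have M0 : 0 < `|M| + 1 by rewrite ltr_wpDl.
  pose s := Num.min (1 : R) (e / (`|M| + 1)).
  have s0 : 0 < s by rewrite /s lt_min ltr01 divr_gt0.
  have s1 : s <= 1 by rewrite /s ge_min lexx.
  have sM : s * M <= e.
    have : s * M <= s * (`|M| + 1).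
      by rewrite ler_pM2l//; have := ler_norm M; lra.
    move=> /le_trans; apply; rewrite -ler_pdivlMr// /s ge_min lexx orbT//.
  have s01 : 0 <= s <= 1 by rewrite (ltW s0).
  have h1 := sc (z m) w s s01.
  have h2 := hz m ((1 - s) *: z m + s *: w).
  rewrite /phi in h2.
  have Ey : (1 - s) *: z m + s *: w - x = (z m - x) + s *: (w - z m).
    by apply/rowP => i; rewrite !mxE; ring.
  rewrite Ey (enorm_sqrD (z m - x)) enormZ exprMn real_normK ?num_real// in h2.
  rewrite dotZr in h2.
  have Ez : dot (zeta m) (w - z m) = - 2 * m.+1%:R * dot (z m - x) (w - z m).
    by rewrite /zeta dotZl -[x - z m]opprB dotNl; ring.
  have : 0 <= s * (h w - X + s * M).
    rewrite /X /M Ez.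
    move: h1 h2; set a := enorm (w - z m) ^+ 2; set b := enorm (z m - x) ^+ 2.
    set d := dot (z m - x) (w - z m); set u := m.+1%:R.
    set h3 := h (_ + _); move: (h (z m)) (h w) => h4 h5 h1 h2.
    have -> : s * (h5 - (h4 + -2 * u * d - c * a) + s * (u * a - c * a)) =
      (c * s * (1 - s) * a + (1 - s) * h4 + s * h5 - h3) +
      (h3 + u * (b + 2 * (s * d) + s ^+ 2 * a) - (h4 + u * b)) by ring.
    by rewrite addr_ge0//; lra.
  by rewrite pmulr_rge0//; lra.
have [U UU sU] := nat_ultrafilter.
have PU : ProperFilter U by exact: ultra_proper.
have FU : Filter U by exact: PU.
have /cvg_ex[zl zetal] := ultra_bounded_cvg UU zetab.
have zcvg : z @ U --> x.
  apply/cvg_enormP => e e0; apply: sU.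
  have [N hN] : exists N : nat, l / e < N%:R.
    exists (Num.bound (l / e)); apply: archi_boundP.
    by rewrite divr_ge0// ltW.
  exists N => // m /= Nm; rewrite -(@ltr_pM2l _ m.+1%:R)//.
  apply: le_lt_trans (zx m) _; rewrite -ltr_pdivrMr//.
  by apply: lt_le_trans hN _; rewrite ler_nat leqW.
exists zl => [|w].
  by apply: (filter_le_cvg PU (enorm_cvg zetal) (cvg_cst (2 * l))).
have wz : (fun m => w - z m) @ U --> w - x.
  by apply: cvgB => //; exact: cvg_cst.
have wz1 := @enorm_cvg _ _ _ U FU _ _ wz.
have wz2 : (fun m => c * enorm (w - z m) ^+ 2) @ U --> c * enorm (w - x) ^+ 2.
  by apply: cvgM; [exact: cvg_cst|exact: (@cvgM _ _ U FU _ _ _ _ wz1 wz1)].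
have hz' := cvg_comp _ _ zcvg (hcont x).
have lhs := @cvgB _ _ _ U FU _ _ _ _ (@cvgD _ _ _ U FU _ _ _ _ hz'
  (@dot_cvg _ _ _ U FU _ _ _ _ zetal wz)) wz2.
have cst : (fun=> h w) @ U --> h w by exact: cvg_cst.
by apply: (filter_le_cvg PU lhs cst) => m; exact: sub.
Qed.

End LipschitzInclusion.

(** Fixing all constants once keeps the dependence of later bounds explicit. The
    linear growth of [F] comes from compactness and the Lipschitz bound, by
    [F_linear_growth]. *)
Record regular_inclusion (R : realType) n (F : 'rV[R]_n -> set 'rV[R]_n)
    (L c0 K Lam : R) : Prop := {
  ri_F1 : F1 F;
  ri_L0 : 0 <= L;
  ri_F2 : forall x y,
    (hausdorff_dist (F x) (F y) <= (L * enorm (x - y))%:E)%E;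
  ri_c0 : 0 <= c0;
  ri_H1 : forall p, semiconvex (c0 * enorm p) (fun x => hamiltonian F x p);
  ri_diff : forall x p, p != 0 -> differentiable (hamiltonian F x) p;
  ri_K0 : 0 <= K;
  ri_H2 : forall x y p, p != 0 ->
    enorm (gradient (hamiltonian F x) p - gradient (hamiltonian F y) p)
      <= K * enorm (y - x);
  ri_Lam0 : 0 <= Lam;
  ri_growth : forall x f, F x f -> enorm f <= Lam * (1 + enorm x) }.

Lemma regular_inclusionP (R : realType) n (F : 'rV[R]_n -> set 'rV[R]_n) :
  F1 F -> F2 F -> H1 F -> H2 F ->
  exists L c0 K Lam, regular_inclusion F L c0 K Lam.
Proof.
move=> f1 [L L0 f2] [c0 c00 h1] [dH [K K0 h2]].
have [Lam LLam gr] := F_linear_growth f1 L0 f2.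
by exists L, c0, K, Lam; split=> //; exact: le_trans LLam.
Qed.

(** * Optimal control of the Euler discretisation *)

Section DiscreteControl.
Context {R : realType} {n : nat}.
Variable F : 'rV[R]_n -> set 'rV[R]_n.
Variables L c0 K Lam : R.
Hypothesis hF : regular_inclusion F L c0 K Lam.
Local Notation H := (hamiltonian F).
Let hF1 := ri_F1 hF.
Let L0 := ri_L0 hF.
Let hF2 := ri_F2 hF.
Let hH1 := ri_H1 hF.
Let diffH := ri_diff hF.
Let growth := ri_growth hF.
Implicit Types x y z p f c : 'rV[R]_n.

Definition velocity x p := gradient (H x) p.

Lemma velocityP x p f : p != 0 -> F x f -> dot f p = H x p -> velocity x p = f.
Proof. by move=> p0; apply: gradient_hamiltonian => //; exact: diffH. Qed.

Lemma velocity_spec x p : p != 0 ->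
  F x (velocity x p) /\ dot (velocity x p) p = H x p.
Proof.
move=> p0; have [f Ff fp] := hamiltonian_attained hF1 x p.
by rewrite (velocityP p0 Ff fp).
Qed.

(** This one-sided estimate plays the part of the adjoint equation: [zeta] is
    the increment of the adjoint vector per unit of time. *)
Lemma hamiltonian_subgradient x p : exists2 zeta,
  enorm zeta <= 2 * L * enorm p &
  forall z, dot zeta (z - x) - c0 * enorm p * enorm (z - x) ^+ 2
    <= H z p - H x p.
Proof.
have [||zeta zb h] := @semiconvex_subgradient R n (c0 * enorm p)
    (L * enorm p) (fun x => H x p) x (hH1 p).
- by rewrite mulr_ge0 ?enorm_ge0.
- by move=> y z; rewrite mulrAC; exact: (hamiltonian_lipschitz hF1 hF2).
exists zeta => [|z]; first by rewrite -mulrA.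
by have := h z; lra.
Qed.

(** The Bellman function of the problem of minimising the distance to [c] after
    [k] Euler steps of size [h], with the velocities chosen freely in [F]. *)
Fixpoint value (h : R) c k z : R :=
  if k is k'.+1 then inf [set value h c k' (z + h *: f) | f in F z]
  else enorm (z - c).

Lemma value_ge0 h c k z : 0 <= value h c k z.
Proof.
elim: k z => [|k IH] z /=; first exact: enorm_ge0.
apply: lb_le_inf; last by move=> _ [f _ <-].
by have [[f Ff] _ _] := hF1 z; exists (value h c k (z + h *: f)), f.
Qed.

Lemma value_le h c k z f : F z f -> value h c k.+1 z <= value h c k (z + h *: f).
Proof.
move=> Ff; apply: ge_inf; last by exists f.
by exists 0 => _ [g _ <-]; exact: value_ge0.
Qed.

(** Both parts are proved together: the minimum over the compact set [F z] is
    attained because [value h c k] is continuous, and attainment at level [k]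
    gives the Lipschitz bound at level [k.+1]. *)
Lemma value_regular h c k : 0 <= h ->
  (forall y z, value h c k y - value h c k z <= (1 + h * L) ^+ k * enorm (y - z)) /\
  (forall z, exists2 f, F z f & value h c k (z + h *: f) = value h c k.+1 z).
Proof.
move=> h0; have hL1 : 0 <= 1 + h * L by rewrite addr_ge0// mulr_ge0.
have attained j : (forall y z, value h c j y - value h c j z
      <= (1 + h * L) ^+ j * enorm (y - z)) ->
    forall z, exists2 f, F z f & value h c j (z + h *: f) = value h c j.+1 z.
  move=> lip z; set l := (1 + h * L) ^+ j in lip.
  have l0 : 0 <= l by exact: exprn_ge0.
  have [F0 _ cF] := hF1 z.
  have [|f Ff hf] := @compact_EVT_min _ _ (fun f => value h c j (z + h *: f)) _ F0 cF.
    apply: continuous_subspaceT => f.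
    apply/(cvgrPdist_le (FF := nbhs_filter f)) => e e0.
    have m0 : 0 < l * h + 1 by rewrite ltr_wpDl// mulr_ge0.
    have e'0 : 0 < e / (l * h + 1) by rewrite divr_gt0.
    have near_f := near_enorm_lt f e'0.
    apply: (@filterS _ _ (nbhs_filter f) _ _ _ near_f) => g /= /ltW fg.
    have E : l * (h * enorm (g - f)) <= e.
      rewrite mulrA (le_trans (ler_wpM2l _ fg)) ?mulr_ge0//.
      by rewrite mulrA mulrAC ger_pMl// ler_pdivrMr//; lra.
    have := lip (z + h *: f) (z + h *: g); have := lip (z + h *: g) (z + h *: f).
    have Efg u v : z + h *: u - (z + h *: v) = h *: (u - v).
      by apply/rowP => i; rewrite !mxE; ring.
    rewrite !Efg !enormZ ger0_norm//.
    rewrite (enormBC f) => h1 h2.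
    by rewrite ler_norml; apply/andP; split; lra.
  move: Ff; rewrite inE => Ff; exists f => //.
  apply/eqP; rewrite eq_le (value_le h c j Ff) andbT.
  apply: lb_le_inf; first by exists (value h c j (z + h *: f)), f.
  by move=> _ [g Fg <-]; apply: hf; rewrite inE.
elim: k => [|k [lip att]].
  have lip0 : forall y z, value h c 0 y - value h c 0 z
      <= (1 + h * L) ^+ 0 * enorm (y - z).
    by move=> y z /=; rewrite expr0 mul1r lerBlDr enorm_triangle.
  by split=> //; exact: attained.
suff lipS : forall y z, value h c k.+1 y - value h c k.+1 z
      <= (1 + h * L) ^+ k.+1 * enorm (y - z).
  by split=> //; exact: attained.
move=> y z; have [f Ff <-] := att z; apply/ler_addgt0Pl => e e0.
set l := (1 + h * L) ^+ k in lip *.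
have l0 : 0 <= l by exact: exprn_ge0.
have m0 : 0 < l * h + 1 by rewrite ltr_wpDl// mulr_ge0.
have e'0 : 0 < e / (l * h + 1) by rewrite divr_gt0.
have [g Fg fg] := F2_select hF2 y Ff e'0.
have h1 := value_le h c k Fg.
have h2 := lip (y + h *: g) (z + h *: f).
have h3 : enorm (y + h *: g - (z + h *: f)) <= enorm (y - z) + h * enorm (f - g).
  rewrite opprD addrACA -scalerBr (le_trans (enormD _ _))// enormZ ger0_norm//.
  by rewrite (enormBC f).
have h4 := le_trans h2 (ler_wpM2l l0 h3).
have h5 := ler_wpM2l (mulr_ge0 l0 h0) fg.
have h6 : l * h * (e / (l * h + 1)) <= e.
  by rewrite mulrA mulrAC ger_pMl// ler_pdivrMr//; lra.
rewrite (enormBC z) in h5.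
rewrite exprSr -/l.
move: h1 h2 h4 h5 h6; set v1 := value _ _ _ _; set v2 := value _ _ _ _.
set v3 := value _ _ _ _; set E := enorm (y - z); set G := enorm (f - g).
set e' := e / _; move=> h1 h2 h4 h5 h6.
have -> : l * (1 + h * L) * E = l * E + l * h * (L * E) by ring.
rewrite mulrDr in h4; rewrite mulrDr in h5; rewrite mulrA in h4; lra.
Qed.

(** The arc steered by the momenta [ps]: at each step it uses the velocity that
    maximises the next momentum, which by (H2) depends on the state in a
    Lipschitz way. *)
Fixpoint euler_arc (h : R) (ps : seq 'rV[R]_n) z :=
  if ps is p :: ps' then euler_arc h ps' (z + h *: velocity z p) else z.

Lemma value_euler_arc h c ps z : all (fun p => p != 0) ps ->
  value h c (size ps) z <= enorm (euler_arc h ps z - c).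
Proof.
elim: ps z => [//|p ps IH] z /andP[p0 ps0].
have [Fv _] := velocity_spec z p0.
exact: (le_trans (value_le h c (size ps) Fv) (IH _ ps0)).
Qed.

End DiscreteControl.

(** * Semiconcavity of the optimal distance along optimal arcs *)

(** One Euler step, started at distance [a] from the reference arc and with a
    relative time shift [d], increases [a^2 + d^2] by a factor [1 + O(e)] only:
    [u] comes from the Lipschitz constant of the feedback and [v] from the
    speed. *)
Lemma step_square (R : realType) (e a d u v b A : R) :
  0 <= e <= 1 -> 0 <= a -> 0 <= d -> 0 <= b -> 0 <= A ->
  0 <= u <= b * e -> 0 <= v <= A * e ->
  (a * (1 + u) + d * v) ^+ 2 + d ^+ 2
    <= (1 + (b * (2 + b) + (1 + b) * A + A ^+ 2) * e) * (a ^+ 2 + d ^+ 2).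
Proof.
move=> /andP[e0 e1] a0 d0 b0 A0 /andP[u0 ub] /andP[v0 vA].
have be : b * e <= b by rewrite ler_piMr.
have uu : u ^+ 2 <= b ^+ 2 * e.
  rewrite expr2 (le_trans (ler_pM _ _ ub ub))//.
  rewrite mulrACA -!expr2 ler_wpM2l ?sqr_ge0// expr2.
  by rewrite -[leRHS]mul1r ler_wpM2r.
have vv : v ^+ 2 <= A ^+ 2 * e.
  rewrite expr2 (le_trans (ler_pM _ _ vA vA))//.
  rewrite mulrACA -!expr2 ler_wpM2l ?sqr_ge0// expr2.
  by rewrite -[leRHS]mul1r ler_wpM2r.
have uv : (1 + u) * v <= (1 + b) * (A * e).
  by rewrite ler_pM ?addr_ge0// lerD2l (le_trans ub).
have ad : 2 * (a * d) <= a ^+ 2 + d ^+ 2.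
  by have := sqr_ge0 (a - d); clear; rewrite sqrrB; lra.
have ad0 : 0 <= a * d by exact: mulr_ge0.
have a20 := sqr_ge0 a; have d20 := sqr_ge0 d.
have h1 : (1 + u) ^+ 2 * a ^+ 2 <= (1 + b * (2 + b) * e) * a ^+ 2.
  by rewrite ler_wpM2r//; lra.
have h2 : 2 * (a * d) * ((1 + u) * v) <= (a ^+ 2 + d ^+ 2) * ((1 + b) * (A * e)).
  by rewrite ler_pM ?mulr_ge0 ?addr_ge0//.
have h3 : v ^+ 2 * d ^+ 2 <= A ^+ 2 * e * d ^+ 2 by rewrite ler_wpM2r.
have h4 : 0 <= b * (2 + b) * e * d ^+ 2 by rewrite !mulr_ge0 ?addr_ge0.
have h5 : 0 <= A ^+ 2 * e * a ^+ 2 by rewrite !mulr_ge0 ?sqr_ge0.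
have -> : (a * (1 + u) + d * v) ^+ 2 = (1 + u) ^+ 2 * a ^+ 2 +
  2 * (a * d) * ((1 + u) * v) + v ^+ 2 * d ^+ 2 by ring.
lra.
Qed.

Section DiscreteSemiconcavity.
Context {R : realType} {n : nat}.
Variable F : 'rV[R]_n -> set 'rV[R]_n.
Variables L c0 K Lam : R.
Hypothesis hF : regular_inclusion F L c0 K Lam.
Local Notation H := (hamiltonian F).
Let hF1 := ri_F1 hF.
Let L0 := ri_L0 hF.
Implicit Types x y z p f c : 'rV[R]_n.

Lemma velocity_lipschitz x y p : p != 0 ->
  enorm (velocity F x p - velocity F y p) <= K * enorm (x - y).
Proof. by move=> p0; rewrite (enormBC x); exact: (ri_H2 hF). Qed.

(** The constant of [step_square] for [u <= B K e] and [v <= A e]. *)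
Definition curvature_rate (B A : R) : R :=
  B * K * (2 + B * K) + (1 + B * K) * A + A ^+ 2.

(** The second-order coefficient after [k] backward steps of relative length
    [1 / N]: it starts from the curvature [1 / (2 r)] of the distance at distance
    [r], and each step multiplies it by the factor of [step_square] and adds the
    contribution of the semiconvexity of the Hamiltonian. *)
Definition curvature_bound (B A P r N : R) (k : nat) : R :=
  (1 + curvature_rate B A / N) ^+ k *
    ((2 * r)^-1 + k%:R / N * ((L + B * c0) * P)).

(** The core of the proof. Along an optimal discrete arc from [x], the adjoint
    vectors are built backwards by [p + h zeta], with [zeta] a subgradient of
    [H ^~ p]. The quadratic bound of the next step says in particular that the
    optimal velocity maximises [p], so it equals the feedback [velocity x p];
    replacing the state by [z] and the step by [eta] while keeping the same
    momenta then changes it by [O(|z - x|)], which keeps the bound quadratic.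
    The step size varies so that, with [N] steps, [N * eta] can be any final
    time: the pair of state and final time is treated as one variable. *)
Lemma discrete_semiconcavity (B A P r N h : R) c k x :
  0 < r -> 1 <= N -> 0 < h -> h * N <= B -> 2 * L * h < 1 -> 0 <= B ->
  r <= value F h c k x ->
  Lam * ((1 + enorm x) * (1 + h * Lam) ^+ k) <= A ->
  (1 + 2 * L * h) ^+ k <= P ->
  exists ps p q, [/\ size ps = k, all (fun p => p != 0) ps,
    (1 - 2 * L * h) ^+ k <= enorm p <= (1 + 2 * L * h) ^+ k,
    `|q| <= k%:R / N * (A * P) &
    forall z eta, 0 <= eta -> eta * N <= B ->
      enorm (euler_arc F eta ps z - c) <= value F h c k x - dot p (z - x)
        - q * (N * (eta - h))
        + curvature_bound B A P r N k * (enorm (z - x) ^+ 2 + (N * (eta - h)) ^+ 2)].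
Proof.
move=> r0 N1 hgt0 hN Lh1 B0; have h0 := ltW hgt0.
have N0 : 0 < N by exact: lt_le_trans N1.
have K0 := ri_K0 hF; have c00 := ri_c0 hF; have Lam0 := ri_Lam0 hF.
have Lh0 : 0 <= 2 * L * h by rewrite !mulr_ge0.
elim: k x => [|k IH] x rv hA hP.
  rewrite /= in rv; have d0 : 0 < enorm (x - c) by exact: lt_le_trans rv.
  exists [::], (- (enorm (x - c))^-1 *: (x - c)), 0; split=> //.
  - rewrite !expr0 enormZ normrN ger0_norm ?invr_ge0 ?enorm_ge0//.
    by rewrite mulVf ?lexx// gt_eqF.
  - by rewrite normr0 !mul0r.
  move=> z eta eta0 etaB /=.
  rewrite /curvature_bound expr0 mul1r !mul0r addr0 subr0 dotZl.
  have -> : z - c = (x - c) + (z - x) by apply/rowP => i; rewrite !mxE; ring.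
  set d := enorm (x - c) in d0 rv *; set m := enorm _.
  have Em : m ^+ 2 = d ^+ 2 + 2 * dot (x - c) (z - x) + enorm (z - x) ^+ 2.
    exact: enorm_sqrD.
  have m_le : m <= (m ^+ 2 + d ^+ 2) / (2 * d).
    rewrite ler_pdivlMr ?mulr_gt0//; have := sqr_ge0 (m - d).
    rewrite sqrrB; lra.
  apply: le_trans m_le _; rewrite Em.
  have rd : (2 * d)^-1 <= (2 * r)^-1.
    by rewrite lef_pV2 ?posrE ?mulr_gt0// ler_pM2l.
  have E2 := sqr_ge0 (enorm (z - x)); have D2 := sqr_ge0 (N * (eta - h)).
  set E := enorm (z - x) ^+ 2 in E2 *; set D := _ ^+ 2 in D2 *.
  set s := dot _ _.
  have -> : (d ^+ 2 + 2 * s + E + d ^+ 2) / (2 * d) =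
    d - (- d^-1 * s) + (2 * d)^-1 * E by field; rewrite gt_eqF.
  rewrite lerD2l (le_trans (ler_wpM2r E2 rd))//.
  by rewrite ler_wpM2l ?lerDl// invr_ge0 mulr_ge0// ltW.
have [f Ff fv] := (value_regular hF c k h0).2 x.
set x' := x + h *: f.
have hLam0 : 0 <= 1 + h * Lam by rewrite addr_ge0// mulr_ge0.
have f_le : enorm f <= Lam * (1 + enorm x) by exact: (ri_growth hF).
have x'_le : 1 + enorm x' <= (1 + enorm x) * (1 + h * Lam).
  have := enormD x (h *: f); rewrite enormZ (ger0_norm h0).
  have := ler_wpM2l h0 f_le; rewrite -/x'.
  move: (enorm x) (enorm f) (enorm x') => *; lra.
have hA' : Lam * ((1 + enorm x') * (1 + h * Lam) ^+ k) <= A.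
  apply: le_trans hA; rewrite ler_wpM2l// exprS mulrA ler_wpM2r//.
  exact: exprn_ge0.
have hP' : (1 + 2 * L * h) ^+ k <= P.
  apply: le_trans hP; rewrite exprS ler_peMl ?exprn_ge0 ?addr_ge0//.
  by rewrite lerDl.
have [|ps [p [q [sps ps0 /andP[pl pu] qb main]]]] := IH x' _ hA' hP'.
  by rewrite fv.
have p0 : p != 0.
  rewrite -enorm_gt0; apply: lt_le_trans pl.
  by rewrite exprn_gt0// subr_gt0.
have pP : enorm p <= P by exact: le_trans pu hP'.
have P0 : 0 <= P by apply: le_trans pP; exact: enorm_ge0.
have fA : enorm f <= A.
  apply: le_trans hA; apply: le_trans f_le _; rewrite ler_wpM2l//.
  by rewrite ler_peMr ?addr_ge0 ?enorm_ge0// exprn_ege1// lerDl mulr_ge0.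
have A0 : 0 <= A by apply: le_trans fA; exact: enorm_ge0.
set sg := curvature_bound B A P r N k in main.
have gc0 : 0 <= curvature_rate B A.
  have BK0 : 0 <= B * K by rewrite mulr_ge0.
  by rewrite /curvature_rate addr_ge0 ?sqr_ge0// addr_ge0// mulr_ge0// addr_ge0.
have sg0 : 0 <= sg.
  have i1 : 0 <= (2 * r)^-1 by rewrite invr_ge0 mulr_ge0// ltW.
  have i2 : 0 <= k%:R / N by rewrite divr_ge0// ltW.
  have i3 : 0 <= (L + B * c0) * P by rewrite mulr_ge0// addr_ge0// mulr_ge0.
  have i4 : 0 <= curvature_rate B A / N by rewrite divr_ge0// ltW.
  by rewrite /sg /curvature_bound mulr_ge0 ?exprn_ge0 ?addr_ge0// mulr_ge0.
(* moving [f] towards [g] cannot decrease the optimal distance, and the quadratic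
   bound turns this into a sign condition on [dot (g - f) p] *)
have fmax : dot f p = H x p.
  apply/eqP; rewrite eq_le hamiltonian_ge//=.
  apply: (hamiltonian_le hF1) => g Fg; rewrite -subr_le0 -dotBl leNgt.
  apply/negP => D0; set D := dot _ _ in D0.
  set M := sg * h * enorm (g - f) ^+ 2.
  have M0 : 0 <= M by rewrite mulr_ge0 ?sqr_ge0// mulr_ge0.
  have DM : 0 < D + M by rewrite ltr_wpDr.
  pose s := D / (D + M).
  have s0 : 0 < s by rewrite divr_gt0.
  have s01 : 0 <= s <= 1 by rewrite ltW//= ler_pdivrMr// mul1r lerDl.
  have h1 := value_le hF h c k (F1_segment hF1 Ff Fg s01).
  have h2 := value_euler_arc hF h c (x + h *: (f + s *: (g - f))) ps0.
  have h3 := main (x + h *: (f + s *: (g - f))) h h0 hN.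
  rewrite sps in h2; have h4 := le_trans h1 (le_trans h2 h3).
  have Ex : x + h *: (f + s *: (g - f)) - x' = (h * s) *: (g - f).
    by apply/rowP => i; rewrite !mxE; ring.
  rewrite Ex subrr !mulr0 expr0n addr0 subr0 -fv dotZr (dotC p) -/D in h4.
  have hs0 : 0 < h * s by rewrite mulr_gt0.
  rewrite enormZ (ger0_norm (ltW hs0)) in h4.
  have h5 : 0 <= h * s * (s * M - D) by clear -h4; rewrite /M; lra.
  rewrite pmulr_rge0// subr_ge0 /s mulrAC ler_pdivlMr// mulrDr in h5.
  have : 0 < D * D by rewrite mulr_gt0.
  by clear -h5; lra.
have fE := velocityP hF p0 Ff fmax.
have [zeta zb hz] := hamiltonian_subgradient hF x p.
exists (p :: ps), (p + h *: zeta), (q + H x p / N); split.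
- by rewrite /= sps.
- by rewrite /= p0.
- have hzb : enorm (h *: zeta) <= 2 * L * h * enorm p.
    by rewrite enormZ (ger0_norm h0) (le_trans (ler_wpM2l h0 zb))//; lra.
  have := enormD p (h *: zeta).
  have := enormDB p (p + h *: zeta); rewrite opprD addNKr enormN.
  move=> h1 h2; rewrite !exprS; apply/andP; split.
    have := ler_wpM2l (ltW _ : 0 <= 1 - 2 * L * h) pl; rewrite subr_gt0 => /(_ Lh1).
    lra.
  have := ler_wpM2l (_ : 0 <= 1 + 2 * L * h) pu; rewrite addr_ge0// => /(_ isT).
  lra.
- rewrite (le_trans (ler_normD _ _))// -natr1 mulrDl mulrDl lerD//.
  rewrite normrM (gtr0_norm (_ : 0 < N^-1)) ?invr_gt0// div1r mulrC.
  rewrite ler_wpM2l ?invr_ge0 ?(ltW N0)//.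
  by rewrite -fmax (le_trans (norm_dot_le _ _))// ler_pM ?enorm_ge0.
- move=> z eta eta0 etaB; rewrite [euler_arc _ _ _ _]/=.
  have [Fv vp] := velocity_spec hF z p0.
  set v := velocity F z p in Fv vp *; set z' := z + eta *: v.
  apply: le_trans (main z' eta eta0 etaB) _; rewrite fv.
  have vf : enorm (v - f) <= K * enorm (z - x).
    by rewrite -fE; exact: velocity_lipschitz.
  have Ez : z' - x' = (z - x) + eta *: (v - f) + (eta - h) *: f.
    by apply/rowP => i; rewrite !mxE; ring.
  set a := enorm (z - x) in vf *; set e := N^-1.
  have a0 : 0 <= a by exact: enorm_ge0.
  have e0 : 0 < e by rewrite invr_gt0.
  have e01 : 0 <= e <= 1 by rewrite ltW//= invf_le1.
  have eN : e * N = 1 by rewrite mulVf// gt_eqF.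
  have etae : eta <= B * e by rewrite ler_pdivlMr.
  set d := N * `|eta - h|.
  have d0 : 0 <= d by rewrite mulr_ge0// ltW.
  have d2 : (N * (eta - h)) ^+ 2 = d ^+ 2 by rewrite !exprMn real_normK ?num_real.
  have ed : `|eta - h| = e * d by rewrite mulrA eN mul1r.
  have zx' : enorm (z' - x') <= a * (1 + eta * K) + d * (A * e).
    rewrite Ez (le_trans (enormD _ _))// lerD//.
      rewrite (le_trans (enormD _ _))// mulrDr mulr1 lerD2l enormZ ger0_norm//.
      by rewrite mulrCA ler_wpM2l// mulrC.
    rewrite enormZ ed.
    by have := ler_wpM2l (mulr_ge0 (ltW e0) d0) fA; clear; lra.
  have BK0 : 0 <= B * K by rewrite mulr_ge0.
  have uB : 0 <= eta * K <= B * K * e.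
    by rewrite mulr_ge0//= mulrAC ler_wpM2r.
  have vA : 0 <= A * e <= A * e by rewrite lexx mulr_ge0// ltW.
  have sq := step_square e01 a0 d0 BK0 A0 uB vA.
  rewrite -/(curvature_rate B A) in sq.
  have zx2 : enorm (z' - x') ^+ 2 <= (a * (1 + eta * K) + d * (A * e)) ^+ 2.
    by rewrite ler_pXn2r// ?nnegrE ?enorm_ge0// (le_trans _ zx') ?enorm_ge0.
  have Ep : dot p (z' - x') = dot p (z - x) + eta * (H z p - H x p) +
      (eta - h) * H x p.
    by rewrite Ez !dotDr !dotZr dotBr !(dotC p _) vp fmax.
  have hz1 := ler_wpM2l eta0 (hz z); rewrite -/a in hz1.
  have a2 := sqr_ge0 a; have dd2 := sqr_ge0 d.
  have ad : 2 * (a * d) <= a ^+ 2 + d ^+ 2.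
    by have := sqr_ge0 (a - d); clear; rewrite sqrrB; lra.
  have err1 : (h - eta) * dot zeta (z - x) <= e * (L * P) * (a ^+ 2 + d ^+ 2).
    have h1 := ler_norm ((h - eta) * dot zeta (z - x)).
    rewrite normrM distrC ed in h1.
    have h2 : `|dot zeta (z - x)| <= 2 * L * P * a.
      rewrite (le_trans (norm_dot_le _ _))// ler_wpM2r// (le_trans zb)//.
      by rewrite ler_wpM2l// mulr_ge0.
    have h3 := ler_wpM2l (mulr_ge0 (ltW e0) d0) h2.
    have h4 := ler_wpM2l (mulr_ge0 (ltW e0) (mulr_ge0 L0 P0)) ad.
    by clear -h1 h3 h4; lra.
  have err2 : eta * (c0 * enorm p * a ^+ 2) <= e * (B * c0 * P) * (a ^+ 2 + d ^+ 2).
    have h1 : c0 * enorm p * a ^+ 2 <= c0 * P * (a ^+ 2 + d ^+ 2).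
      by rewrite ler_pM ?mulr_ge0 ?enorm_ge0// ?ler_wpM2l// lerDl.
    have h2 : 0 <= c0 * enorm p * a ^+ 2 by rewrite !mulr_ge0 ?enorm_ge0.
    by have := ler_pM eta0 h2 etae h1; clear; lra.
  have sgS : (1 + curvature_rate B A * e) * sg + e * ((L + B * c0) * P)
      <= curvature_bound B A P r N k.+1.
    rewrite /sg /curvature_bound -/e exprS -mulrA.
    set G := (1 + _) ^+ k; set W := (L + B * c0) * P.
    have G1 : 1 <= (1 + curvature_rate B A * e) * G.
      by rewrite -exprS exprn_ege1// lerDl mulr_ge0// ltW.
    have W0 : 0 <= e * W by rewrite !mulr_ge0 ?addr_ge0 ?mulr_ge0// ltW.
    have := ler_wpM2l W0 G1; rewrite mulr1 -natr1.
    by set g := 1 + _; clear; lra.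
  have T0 : 0 <= a ^+ 2 + d ^+ 2 by rewrite addr_ge0.
  have f1 := ler_wpM2r T0 sgS.
  have f2 := ler_wpM2l sg0 (le_trans (_ : _ <= _ + d ^+ 2) sq).
  have {}f2 := f2 (enorm (z' - x') ^+ 2 + d ^+ 2); rewrite lerD2r in f2.
  have {}f2 := f2 zx2.
  rewrite Ep d2 dotDl dotZl.
  have HN : (q + H x p / N) * (N * (eta - h)) = q * (N * (eta - h)) + (eta - h) * H x p.
    by rewrite mulrDl -/e [_ / N]/(_ * e) -mulrA (mulrA e) eN mul1r (mulrC (H x p)).
  rewrite HN; set qq := q * _; set hh := (eta - h) * _.
  set zd := dot zeta _ in err1 hz1 *; set hd := H z p - H x p in hz1 *.
  rewrite mulrBr in hz1.
  move: f1 f2 err1 err2 hz1; set df := curvature_bound _ _ _ _ _ _.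
  set gc := curvature_rate _ _; set T := a ^+ 2 + d ^+ 2.
  set W := (L + B * c0) * P.
  set t1 := eta * hd; set t2 := eta * (c0 * _ * _); set z2 := enorm _ ^+ 2.
  move=> f1 f2 err1 err2 hz1.
  have EW : e * (L * P) * T + e * (B * c0 * P) * T = e * W * T by rewrite /W; ring.
  by clear -f1 f2 err1 err2 hz1 EW; lra.
Qed.

End DiscreteSemiconcavity.

(** * Mean value inequality for absolutely continuous functions *)

(** Real induction: the supremum of the times at which [Q] holds is crossed by
    the step at that supremum, so it is [b]. *)
Lemma real_creeping (R : realType) (a b : R) (Q : R -> Prop) : a <= b -> Q a ->
  (forall T, a <= T <= b -> exists2 d, 0 < d & forall t t', a <= t ->
     T - d < t -> t <= T -> T <= t' -> t' < T + d -> t' <= b -> Q t -> Q t') ->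
  Q b.
Proof.
move=> ab Qa step; pose E := [set t | [/\ a <= t, t <= b & Q t]].
have Ea : E a by split.
have hE : has_sup E by split; [exists a|exists b => t []].
set T := sup E.
have aT : a <= T by apply: ub_le_sup => //; case: hE.
have Tb : T <= b by apply: ge_sup; [exists a|move=> t []].
have [|d d0 hd] := step T; first by rewrite aT.
have [t [ta tb Qt] tT] := sup_adherent d0 hE.
have tleT : t <= T by apply: ub_le_sup => //; case: hE.
pose t' := Num.min b (T + d / 2).
have Tt' : T <= t' by rewrite le_min Tb lerDl divr_ge0// ltW.
have t'd : t' < T + d.
  by apply: le_lt_trans (_ : T + d / 2 < _); rewrite ?ge_min ?lexx ?orbT//; lra.
have t'b : t' <= b by rewrite ge_min lexx.
have Qt' : Q t' := hd t t' ta tT tleT Tt' t'd t'b Qt.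
have t'T : t' <= T by apply: ub_le_sup; [case: hE|split => //; exact: le_trans Tt'].
suff <- : t' = b by [].
move: t'T; rewrite /t'; case: (leP b (T + d / 2)) => // _ h.
by exfalso; move: h; rewrite leNgt ltrDl divr_gt0.
Qed.

Section AbsoluteContinuity.
Context {R : realType}.
Local Notation mu := (@lebesgue_measure R).

Lemma negligible_open_cover (N : set R) (e : R) : mu.-negligible N -> 0 < e ->
  exists U : set R, [/\ open U, N `<=` U & (mu U < e%:E)%E].
Proof.
move=> /negligible_outer_measure N0 e0.
have e20 : 0 < e / 2 by rewrite divr_gt0.
have [U [oU NU mU]] := outer_measure_open_le N e20.
exists U; split=> //; apply: le_lt_trans mU _.
by rewrite N0 add0e lte_fin; lra.
Qed.

(** Families of intervals are listed from right to left, so that adding an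
    interval on the right of a family is a cons. *)
Fixpoint stacked (U : set R) (a t : R) (l : seq (R * R)) : Prop :=
  if l is u :: l' then
    [/\ u.1 <= u.2, u.2 <= t, `[u.1, u.2] `<=` U & stacked U a u.1 l']
  else a <= t.

Lemma stacked_ge U a t l : stacked U a t l -> a <= t.
Proof.
elim: l t => [//|u l IH] t /= [u12 u2t _ /IH au].
exact: le_trans au (le_trans u12 u2t).
Qed.

Lemma stacked_widen U a t t' l : t <= t' -> stacked U a t l -> stacked U a t' l.
Proof.
case: l => [|u l] /= tt'; first by move/le_trans; apply.
by case=> u12 u2t uU ul; split=> //; exact: le_trans tt'.
Qed.

(** The half-open parts of the intervals are disjoint pieces of [U]. *)
Lemma stacked_length U a t l : open U -> (mu U < +oo)%E -> stacked U a t l ->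
  ((\sum_(u <- l) (u.2 - u.1))%:E <= mu (U `&` `]-oo, t[))%E.
Proof.
move=> oU Uoo; have mI t' : measurable (U `&` [set` `]-oo, t'[%R]).
  by apply: measurableI => //; exact: measurable_realfun.open_measurable.
elim: l t => [|u l IH] t /=; first by rewrite big_nil.
move=> [u12 u2t uU /IH h]; rewrite big_cons EFinD addeC.
have mu_u : mu `[u.1, u.2[ = (u.2 - u.1)%:E.
  rewrite lebesgue_measure_itv/= lte_fin; case: ifPn; first by rewrite EFinB.
  rewrite -leNgt => u21; have -> : u.1 = u.2 by apply/le_anti/andP.
  by rewrite subrr.
rewrite -mu_u; apply: le_trans (leeD2r _ h) _.
rewrite -measureU//; last first.
  apply/seteqP; split=> // s/= [[_]]; rewrite !in_itv/= => su /andP[us _].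
  by move: su; rewrite ltNge us.
  exact: mI.
apply: (le_measure mu); rewrite ?inE//; [by apply: measurableU => //; exact: mI|exact: mI|].
move=> s/= [[Us]|]; rewrite !in_itv/=.
  by move=> su; split=> //; apply: lt_le_trans su (le_trans u12 u2t).
move=> /andP[us su]; split; last exact: lt_le_trans u2t.
by apply: uU; rewrite /= in_itv/= us ltW.
Qed.

Lemma stacked_nth U a t l i : stacked U a t l -> (i < size l)%N ->
  [/\ a <= (nth (0, 0) l i).1, (nth (0, 0) l i).1 <= (nth (0, 0) l i).2 &
      (nth (0, 0) l i).2 <= t].
Proof.
elim: l t i => [//|u l IH] t [|i] /= [u12 u2t _ ul]; first last.
  rewrite ltnS => /(IH _ _ ul)[h1 h2 h3]; split=> //.
  exact: le_trans h3 (le_trans u12 u2t).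
by move=> _; split=> //; exact: stacked_ge ul.
Qed.

Lemma stacked_disjoint U a t l i j : stacked U a t l -> (i < j < size l)%N ->
  (nth (0, 0) l j).2 <= (nth (0, 0) l i).1.
Proof.
elim: l t i j => [|u l IH] t i [|j] /=; rewrite ?ltn0 ?andbF//.
case: i => [|i] [u12 u2t _ ul] /=; last by rewrite !ltnS; exact: IH ul.
by rewrite ltnS => /(stacked_nth ul)[].
Qed.

(** The exceptional null set lies in an open [U] of small measure. Creeping from
    [a] to [b], the increment of [phi] is bounded by the derivative at good
    points, and by the variation over intervals contained in [U] at the others;
    absolute continuity makes the total of the latter small. *)
Lemma ac_mean_value (a b M : R) (phi : R -> R) : a <= b ->
  (forall e : R, 0 < e -> exists2 d : R, 0 < d &
    forall (k : nat) (s t : 'I_k -> R),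
      (forall i, [/\ a <= s i, s i <= t i & t i <= b]) ->
      trivIset setT (fun i => [set` `]s i, t i[%R]) ->
      \sum_(i < k) (t i - s i) < d ->
      \sum_(i < k) `|phi (t i) - phi (s i)| < e) ->
  {ae mu, forall t : R, a <= t <= b -> derivable phi t 1 /\ 'D_1 phi t <= M} ->
  phi b - phi a <= M * (b - a).
Proof.
move=> ab ac aeD.
suff main e : 0 < e -> phi b - phi a <= (M + e) * (b - a) + (e + e).
  apply/ler_addgt0Pl => e e0.
  have ba1 : 0 < b - a + 2 by rewrite ltr_wpDl// subr_ge0.
  have e'0 : 0 < e / (b - a + 2) by rewrite divr_gt0.
  have -> : e = e / (b - a + 2) * (b - a + 2) by rewrite divfK// gt_eqF.
  by have := main _ e'0; lra.
move=> e0; have [d d0 hd] := ac e e0.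
have M1 : 0 < `|M| + 1 by rewrite ltr_wpDl.
have [U [oU NU Ud]] : exists U, [/\ open U,
    ~` [set t | a <= t <= b -> derivable phi t 1 /\ 'D_1 phi t <= M] `<=` U &
    (mu U < (Num.min d (e / (`|M| + 1)))%:E)%E].
  by apply: (negligible_open_cover aeD); rewrite lt_min d0 divr_gt0.
have Uoo : (mu U < +oo)%E by apply: lt_trans Ud _; rewrite ltry.
(* the term in [`|M|] compensates for the slope [M] on the intervals of [l], as
   [M] may be negative *)
pose Q t := exists2 l, stacked U a t l & phi t - phi a <= (M + e) * (t - a) +
  \sum_(u <- l) (`|phi u.2 - phi u.1| + `|M| * (u.2 - u.1)).
have [l lU hl] : Q b.
  apply: (real_creeping ab).
    by exists [::] => //=; rewrite big_nil !subrr mulr0 addr0.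
  move=> T aTb; have [UT|UT] := pselect (U T).
    have [r/= r0 hr] := (nbhs_ballP T U).1 (open_nbhs_nbhs (conj oU UT)).
    exists r => // t t' ta Tt tT Tt' t'T t'b [l lU hl].
    have tt' : t <= t' by exact: le_trans Tt'.
    exists ((t, t') :: l) => /=.
      split=> // s /=; rewrite in_itv/= => /andP[ts st']; apply: hr.
      by rewrite /ball/= ltr_norml; apply/andP; split; lra.
    rewrite big_cons/=; have := ler_norm (phi t' - phi t).
    have := ler_norm (- M); rewrite normrN => nM.
    have := ler_wpM2r (_ : 0 <= t' - t) nM; rewrite subr_ge0 => /(_ tt') nM'.
    have : 0 <= e * (t' - t) by rewrite mulr_ge0 ?subr_ge0// ltW.
    lra.
  have [dT DT] : derivable phi T 1 /\ 'D_1 phi T <= M.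
    by apply: contrapT => h; apply: UT; apply: NU => /= /(_ aTb).
  have [r r0 hr] := derivable_expand dT e0.
  exists r => // t t' ta Tt tT Tt' t'T t'b [l lU hl].
  have tt' : t <= t' by exact: le_trans Tt'.
  exists l; first exact: stacked_widen lU.
  have h1 : `|t' - T| < r by rewrite ger0_norm; lra.
  have h2 : `|t - T| < r by rewrite ler0_norm; lra.
  have := hr _ h1; have := hr _ h2.
  have unit_shift (w : R) : (w - T) *: 1 + T = w.
    by rewrite /GRing.scale/= mulr1 subrK.
  rewrite !unit_shift.
  rewrite (ger0_norm (_ : 0 <= t' - T)) ?subr_ge0//.
  rewrite (ler0_norm (_ : t - T <= 0)) ?subr_le0//.
  rewrite !ler_norml => /andP[k1 _] /andP[_ k2].
  have k3 : (t' - T) * 'D_1 phi T <= (t' - T) * M by rewrite ler_wpM2l// subr_ge0.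
  have k4 : (T - t) * 'D_1 phi T <= (T - t) * M by rewrite ler_wpM2l// subr_ge0.
  move: k1 k2; rewrite /GRing.scale/= => k1 k2; lra.
apply: le_trans hl _; rewrite lerD2l big_split/= -mulr_sumr.
have len : \sum_(u <- l) (u.2 - u.1) < Num.min d (e / (`|M| + 1)).
  rewrite -lte_fin; apply: le_lt_trans Ud.
  apply: le_trans (stacked_length oU Uoo lU) _; apply: (le_measure mu); rewrite ?inE.
  - by apply: measurableI => //; exact: measurable_realfun.open_measurable.
  - exact: measurable_realfun.open_measurable.
  - exact: subIsetl.
move: len; rewrite lt_min => /andP[len_d len_e].
apply: lerD; last first.
  have : 0 <= \sum_(u <- l) (u.2 - u.1).
    rewrite (big_nth (0, 0)) big_mkord sumr_ge0// => i _.
    by rewrite subr_ge0; have [] := stacked_nth lU (ltn_ord i).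
  rewrite ltr_pdivlMr// in len_e; have := ltW len_e; lra.
apply: ltW.
pose s (i : 'I_(size l)) := (nth (0, 0) l i).1.
pose t (i : 'I_(size l)) := (nth (0, 0) l i).2.
have := hd _ s t; rewrite (big_nth (0, 0)) big_mkord; apply.
- by move=> i; have [] := stacked_nth lU (ltn_ord i).
- move=> i j _ _ [z/= []]; rewrite !in_itv/= => /andP[si ti] /andP[sj tj].
  apply/val_inj/eqP; case: (ltngtP i j) => // ij.
    have := stacked_disjoint (i := i) (j := j) lU; rewrite ij ltn_ord => /(_ isT).
    by rewrite leNgt (lt_trans si).
  have := stacked_disjoint (i := j) (j := i) lU; rewrite ij ltn_ord => /(_ isT).
  by rewrite leNgt (lt_trans sj).
- by move: len_d; rewrite (big_nth (0, 0)) big_mkord.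
Qed.

End AbsoluteContinuity.

(** * Trajectories of the differential inclusion *)

Lemma open_enorm_ball (R : realType) n (U : set 'rV[R]_n) x : open U -> U x ->
  exists2 e : R, 0 < e & forall w, enorm (w - x) < e -> U w.
Proof.
move=> oU Ux; have [e/= e0 he] := (nbhs_ballP x U).1 (open_nbhs_nbhs (conj oU Ux)).
exists e => // w we; apply: he; rewrite -ball_normE/= distrC.
exact: le_lt_trans (norm_le_enorm _) we.
Qed.

Lemma exp_bound (R : realType) (a : R) k : 0 <= a ->
  (1 + a) ^+ k <= expR (k%:R * a).
Proof.
move=> a0; rewrite expRM_natl.
by apply: lerXn2r; rewrite ?nnegrE ?expR_ge0 ?addr_ge0 ?expR_ge1Dx.
Qed.

Section Trajectories.
Context {R : realType} {n : nat}.
Variable F : 'rV[R]_n -> set 'rV[R]_n.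
Variables L c0 K Lam : R.
Hypothesis hF : regular_inclusion F L c0 K Lam.
Local Notation H := (hamiltonian F).
Let hF1 := ri_F1 hF.
Let L0 := ri_L0 hF.
Variables (x0 : 'rV[R]_n) (y : R -> 'rV[R]_n).
Hypothesis traj : trajectory F x0 y.

Lemma trajectory_continuous b e : 0 <= b -> 0 < e ->
  exists2 d : R, 0 < d & forall s t, 0 <= s -> s <= t -> t <= b -> t - s < d ->
    enorm (y t - y s) < e.
Proof.
case: traj => _ ac _ b0 e0; have [d d0 hd] := ac b b0 e e0.
exists d => // s t s0 st tb tsd.
have := hd 1%N (fun=> s) (fun=> t); rewrite !big_ord1; apply=> //.
by move=> i j _ _ _; rewrite !ord1.
Qed.

Lemma dot_derive t p : derivable y t 1 ->
  derivable (fun s => dot (y s) p) t 1 /\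
  'D_1 (fun s => dot (y s) p) t = dot (derive1 y t) p.
Proof.
move=> dy; have yD : (fun h : R => h^-1 *: (y (h *: 1 + t) - y t)) @ 0^' -->
    derive1 y t by rewrite derive1E; exact: dy.
have cp : (fun=> p) @ (0 : R)^' --> p by exact: cvg_cst.
have := dot_cvg yD cp.
rewrite (_ : (fun h : R => _) =
    (fun h : R => h^-1 *: (dot (y (h *: 1 + t)) p - dot (y t) p))); last first.
  by apply/funext => h; rewrite dotZl dotBl.
move=> dD; split.
  by apply/cvg_ex; exists (dot (derive1 y t) p); exact: dD.
by apply: cvg_lim; [exact: Rhausdorff|exact: dD].
Qed.

(** Only the values of [F] along the arc are constrained, which bounds the
    derivative almost everywhere; [ac_mean_value] integrates the bound. *)
Lemma trajectory_increment a b p M : 0 <= a -> a <= b ->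
  (forall t, a <= t <= b -> forall f, F (y t) f -> dot f p <= M) ->
  dot (y b - y a) p <= M * (b - a).
Proof.
move=> a0 ab hM; case: traj => _ ac aeD; rewrite dotBl.
apply: (@ac_mean_value R a b M (fun t => dot (y t) p)) => //.
  move=> e e0; have p1 : 0 < enorm p + 1 by rewrite ltr_wpDl ?enorm_ge0.
  have e'0 : 0 < e / (enorm p + 1) by rewrite divr_gt0.
  have [d d0 hd] := ac b (le_trans a0 ab) _ e'0.
  exists d => // k s t st tri len.
  have {}st i : [/\ 0 <= s i, s i <= t i & t i <= b].
    by have [? ? ?] := st i; split=> //; exact: le_trans a0 _.
  have := hd k s t st tri len; rewrite ltr_pdivlMr//; apply: le_lt_trans.
  rewrite mulr_suml ler_sum// => i _; rewrite -dotBl.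
  apply: le_trans (norm_dot_le _ _) _.
  by rewrite ler_wpM2l ?enorm_ge0// lerDl.
apply: (negligibleS _ aeD) => t /= nt h; apply: nt => /andP[a_t tb].
have [dy Fy] := h (le_trans a0 a_t).
have [dphi ->] := dot_derive p dy; split=> //.
by apply: (hM t) => //; apply/andP.
Qed.

Lemma trajectory_speed a b A : 0 <= a -> a <= b -> 0 <= A ->
  (forall t, a <= t <= b -> forall f, F (y t) f -> enorm f <= A) ->
  enorm (y b - y a) <= A * (b - a).
Proof.
move=> a0 ab A0 hA; set u := y b - y a.
have [->|u0] := eqVneq u 0; first by rewrite enorm0 mulr_ge0// subr_ge0.
have u1 : 0 < enorm u by rewrite enorm_gt0.
rewrite -(ler_pM2r u1) -expr2 enorm_sqr mulrAC.
apply: trajectory_increment => // t tab f Ff.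
by rewrite (le_trans (dot_le _ _))// ler_wpM2r ?enorm_ge0// (hA t).
Qed.

Lemma trajectory_bounded b : 0 <= b -> exists2 A, 0 <= A &
  forall t, 0 <= t <= b -> forall f, F (y t) f -> enorm f <= A.
Proof.
move=> b0; suff [A hA] : exists A, forall t, 0 <= t <= b -> enorm (y t) <= A.
  have A0 : 0 <= A.
    by apply: le_trans (enorm_ge0 (y 0)) (hA _ _); rewrite lexx b0.
  exists (Lam * (1 + A)) => [|t tb f Ff].
    by rewrite mulr_ge0 ?addr_ge0// (ri_Lam0 hF).
  rewrite (le_trans ((ri_growth hF) _ _ Ff))// ler_wpM2l ?(ri_Lam0 hF)//.
  by rewrite lerD2l hA.
have [d d0 hd] := trajectory_continuous b0 ltr01.
apply: (@real_creeping R 0 b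
  (fun T => exists A, forall t, 0 <= t <= T -> enorm (y t) <= A) b0).
  exists (enorm (y 0)) => t t0; suff -> : t = 0 by [].
  by apply/le_anti; rewrite andbC.
move=> T _; exists (d / 2) => [|t t' t0 tT _ _ Tt' t'b [A hA]].
  by rewrite divr_gt0.
exists (A + 1) => s /andP[s0 st'].
have [st|ts] := leP s t; first by rewrite (le_trans (hA s _)) ?s0// lerDl.
have := hd t s t0 (ltW ts) (le_trans st' t'b); rewrite ltrBlDl => h.
have := enormDB (y s) (y t); have := hA t; rewrite t0 lexx => /(_ isT).
have : enorm (y s - y t) < 1 by apply: h; lra.
lra.
Qed.

Lemma first_hitting_time (S : set 'rV[R]_n) t1 : closed S -> ~ S x0 ->
  0 <= t1 -> S (y t1) -> exists theta, [/\ 0 < theta <= t1, S (y theta),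
    forall t, 0 <= t < theta -> ~ S (y t) & closure (~` S) (y theta)].
Proof.
move=> cS nSx t10 St1; have y0 : y 0 = x0 by case: traj.
pose E := [set t | 0 <= t /\ S (y t)].
have hE : has_inf E by split; [exists t1|exists 0 => t []].
set theta := inf E.
have th0 : 0 <= theta by apply: lb_le_inf; [exists t1|move=> t []].
have th1 : theta <= t1 by apply: ge_inf => //; case: hE.
have before t : 0 <= t < theta -> ~ S (y t).
  move=> /andP[t0 tth] St; move: tth; rewrite ltNge => /negP; apply.
  by apply: ge_inf; [case: hE|split].
have Sth : S (y theta).
  apply: contrapT => nS.
  have [e e0 he] := open_enorm_ball (closed_openC cS) nS.
  have [d d0 hd] := trajectory_continuous t10 e0.
  have [t [t0 St] td] := inf_adherent d0 hE.
  have tht : theta <= t by apply: ge_inf; [case: hE|split].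
  have [tt1|t1t] := leP t t1.
    by apply: (he _ _ St); apply: hd => //; rewrite ltrBlDl.
  apply: (he _ _ St1); apply: hd => //; rewrite ltrBlDl.
  exact: lt_trans td.
have thpos : 0 < theta.
  rewrite lt_neqAle th0 andbT; apply/eqP => th00.
  by apply: nSx; rewrite -y0 th00.
exists theta; split=> //; first by rewrite thpos.
move=> B /nbhs_ballP[e/= e0 he].
have [d d0 hd] := trajectory_continuous th0 e0.
(* a slightly earlier time, which is still outside [S] *)
pose t := Num.max 0 (theta - d / 2).
have d2 : 0 < d / 2 by rewrite divr_gt0.
have t0 : 0 <= t by rewrite le_max lexx.
have tth : t < theta by rewrite gt_max thpos/= ltrBlDr ltrDl.
exists (y t); split; first by apply: before; rewrite t0.
apply: he; rewrite -ball_normE/=.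
apply: le_lt_trans (norm_le_enorm _) _; apply: hd => //; first exact: ltW.
have : theta - d / 2 <= t by rewrite le_max lexx orbT.
lra.
Qed.

(** The discrete optimal value is at most what a trajectory achieves, up to the
    step size: each increment of the trajectory is almost an admissible step. *)
Lemma value_tracking (N : nat) theta A c :
  0 < theta -> 0 <= A ->
  (forall t, 0 <= t <= theta -> forall f, F (y t) f -> enorm f <= A) ->
  forall h, h = theta / N.+1%:R ->
  value F h c N.+1 x0 <=
    enorm (y theta - c) + expR (L * theta) * (L * A * theta) * h.
Proof.
move=> th0 A0 hA h Eh; have y0 : y 0 = x0 by case: traj.
have h0 : 0 < h by rewrite Eh divr_gt0.
have hN : h * N.+1%:R = theta by rewrite Eh divfK// gt_eqF.
pose C := L * A.
have C0 : 0 <= C by rewrite mulr_ge0.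
have main k w : (k <= N.+1)%N -> value F h c k w <= enorm (y theta - c) +
    (1 + h * L) ^+ k *
      (enorm (w - y (theta - k%:R * h)) + k%:R * (C * h ^+ 2)).
  elim: k w => [|k IH] w kN.
    rewrite /= expr0 mul1r !mul0r subr0 addr0 [leRHS]addrC.
    exact: enorm_triangle.
  set t := theta - k.+1%:R * h.
  have Et : theta - k%:R * h = t + h by rewrite /t -natr1; ring.
  have t0 : 0 <= t by rewrite subr_ge0 -hN mulrC ler_pM2l// ler_nat.
  have th : t + h <= theta.
    by rewrite -Et lerBlDr lerDl mulr_ge0// ltW.
  have sub_le s : t <= s <= t + h -> 0 <= s <= theta.
    by move=> /andP[ts sth]; rewrite (le_trans t0 ts) (le_trans sth th).
  pose u := h^-1 *: (y (t + h) - y t).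
  have hu p : dot u p <= H w p + (L * enorm (w - y t) + C * h) * enorm p.
    rewrite dotZl mulrC ler_pdivrMr//.
    have thh : t + h - t = h by ring.
    rewrite -[X in _ <= _ * X]thh.
    apply: trajectory_increment => //; first by rewrite lerDl ltW.
    move=> s ts f Ff; have [s0 sth] := andP (sub_le s ts).
    have [ts1 ts2] := andP ts.
    have h1 := hamiltonian_ge hF1 p Ff.
    have h2 := hamiltonian_lipschitz hF1 (ri_F2 hF) (y s) (y t) p.
    have h3 := hamiltonian_lipschitz hF1 (ri_F2 hF) (y t) w p.
    have h4 : enorm (y s - y t) <= A * h.
      apply: le_trans (_ : A * (s - t) <= _); last first.
        by rewrite ler_wpM2l// lerBlDl.
      apply: trajectory_speed => // r /andP[r1 r2].
      by apply: hA; rewrite (le_trans t0 r1) (le_trans r2 sth).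
    have h5 := ler_wpM2r (enorm_ge0 p) (ler_wpM2l L0 h4).
    rewrite (enormBC (y t)) in h3; rewrite /C.
    move: h1 h2 h3 h5; move: (enorm p) (enorm _) (enorm _) => *; lra.
  have [|f Ff uf] := support_nearest hF1 (x := w) _ hu.
    by rewrite addr_ge0// mulr_ge0 ?enorm_ge0// ltW.
  apply: le_trans (value_le hF h c k Ff) _.
  apply: le_trans (IH _ (ltnW kN)) _; rewrite lerD2l Et (exprSr (1 + h * L)) -[leRHS]mulrA.
  have hL1 : 0 <= 1 + h * L by rewrite addr_ge0// mulr_ge0// ltW.
  rewrite ler_wpM2l ?exprn_ge0//.
  have Ew : w + h *: f - y (t + h) = (w - y t) - h *: (u - f).
    rewrite scalerBr scalerA mulfV ?gt_eqF// scale1r.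
    by apply/rowP => i; rewrite !mxE; ring.
  have h1 := enormB (w - y t) (h *: (u - f)); rewrite -Ew enormZ in h1.
  rewrite (gtr0_norm h0) in h1.
  have h2 := ler_wpM2l (ltW h0) uf.
  have h3 : 0 <= h * L * (k.+1%:R * (C * h ^+ 2)).
    by rewrite !mulr_ge0 ?sqr_ge0// ltW.
  rewrite -natr1 in h3 *.
  set Y := y (t + h) in h1 *; set Y' := y t in h1 h2 *.
  move: h1 h2 h3; move: (enorm _) (enorm _) (enorm _) => a1 a2 a3 h1 h2 h3.
  lra.
have := main N.+1 x0 (leqnn _).
have -> : theta - N.+1%:R * h = 0 by rewrite mulrC hN subrr.
rewrite y0 subrr enorm0 add0r.
move=> /le_trans; apply; rewrite lerD2l.
have hL0 : 0 <= h * L by rewrite mulr_ge0// ltW.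
have := exp_bound N.+1 hL0.
have -> : N.+1%:R * (h * L) = L * theta by rewrite -hN; ring.
move=> e1.
have -> : expR (L * theta) * (L * A * theta) * h =
    expR (L * theta) * (N.+1%:R * (C * h ^+ 2)).
  by rewrite -!mulrA; congr (_ * _); rewrite -hN /C; ring.
by rewrite ler_wpM2r// mulr_ge0// mulr_ge0 ?sqr_ge0.
Qed.

End Trajectories.

(** * Trajectories that follow a feedback *)

Lemma derive1_quadratic (R : realType) n (y : R -> 'rV[R]_n) t v (C d : R) :
  0 < d -> (forall h, `|h| < d -> enorm (y (h + t) - y t - h *: v) <= C * h ^+ 2) ->
  derivable y t 1 /\ derive1 y t = v.
Proof.
move=> d0 hd.
have qc : (fun h : R => h^-1 *: (y (h *: 1 + t) - y t)) @ 0^' --> v.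
  apply/cvg_enormP => e e0.
  have C1 : 0 < `|C| + 1 by rewrite ltr_wpDl.
  have r0 : 0 < Num.min d (e / (`|C| + 1)) by rewrite lt_min d0 divr_gt0.
  apply/nbhs_ballP; exists (Num.min d (e / (`|C| + 1))) => // h.
  rewrite -ball_normE/= sub0r normrN lt_min => /andP[hlt he] h0.
  have h0' : 0 < `|h| by rewrite normr_gt0.
  have -> : h *: 1 + t = h + t by rewrite /GRing.scale/= mulr1.
  have -> : h^-1 *: (y (h + t) - y t) - v = h^-1 *: (y (h + t) - y t - h *: v).
    by rewrite [RHS]scalerBr scalerA mulVf// scale1r.
  rewrite enormZ normfV mulrC ltr_pdivrMr//.
  apply: le_lt_trans (hd h hlt) _.
  rewrite -[h ^+ 2]real_normK ?num_real// expr2 mulrA ltr_pM2r//.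
  apply: le_lt_trans (_ : (`|C| + 1) * `|h| < _).
    by rewrite ler_wpM2r//; have := ler_norm C; lra.
  by rewrite mulrC -ltr_pdivlMr.
split; first by apply/cvg_ex; exists v; exact: qc.
by rewrite derive1E; apply: cvg_lim; [exact: norm_hausdorff|exact: qc].
Qed.

Section LipschitzODE.
Context {R : realType} {n : nat}.
Variables (G : 'rV[R]_n -> 'rV[R]_n) (K Lam : R).
Hypothesis K0 : 0 <= K.
Hypothesis Lam0 : 0 <= Lam.
Hypothesis Glip : forall x z, enorm (G x - G z) <= K * enorm (x - z).
Hypothesis Ggrowth : forall x, enorm (G x) <= Lam * (1 + enorm x).

Fixpoint euler (e : R) x i : 'rV[R]_n :=
  if i is i'.+1 then euler e x i' + e *: G (euler e x i') else x.

Lemma euler_growth e x i : 0 <= e ->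
  1 + enorm (euler e x i) <= (1 + enorm x) * expR (Lam * (i%:R * e)).
Proof.
move=> e0; have eL0 : 0 <= e * Lam by rewrite mulr_ge0.
suff h : 1 + enorm (euler e x i) <= (1 + enorm x) * (1 + e * Lam) ^+ i.
  apply: le_trans h _; rewrite ler_wpM2l ?addr_ge0 ?enorm_ge0//.
  have -> : Lam * (i%:R * e) = i%:R * (e * Lam) by ring.
  exact: exp_bound.
elim: i => [|i IH] /=; first by rewrite expr0 mulr1.
have := enormD (euler e x i) (e *: G (euler e x i)).
rewrite enormZ (ger0_norm e0); have := ler_wpM2l e0 (Ggrowth (euler e x i)).
have := ler_wpM2l (_ : 0 <= 1 + e * Lam) IH; rewrite addr_ge0// => /(_ isT).
rewrite exprS; move: (_ ^+ i) (enorm _) (enorm _) (enorm _) (enorm _) => *; lra.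
Qed.

(** Over [j] steps the field drifts by at most [K * S * (j e)], hence the
    quadratic error, uniformly in the step [e]. *)
Lemma euler_increment e x S i j : 0 <= e ->
  (forall l, (l <= i + j)%N -> enorm (G (euler e x l)) <= S) ->
  enorm (euler e x (i + j) - euler e x i) <= S * (j%:R * e) /\
  enorm (euler e x (i + j) - euler e x i - (j%:R * e) *: G (euler e x i))
    <= K * S * (j%:R * e) ^+ 2.
Proof.
move=> e0; elim: j => [|j IH] hS.
  by rewrite addn0 !subrr mul0r scale0r subr0 enorm0 expr0n !mulr0.
have S0 : 0 <= S by apply: le_trans (enorm_ge0 _) (hS 0%N _).
have [|h1 h2] := IH; first by move=> l lj; apply: hS; rewrite addnS (leq_trans lj).
rewrite addnS /= -natr1.
set u := euler e x (i + j) in h1 h2 *; set v := euler e x i in h1 h2 *.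
split.
  have -> : u + e *: G u - v = (u - v) + e *: G u by rewrite addrAC.
  rewrite (le_trans (enormD _ _))// enormZ (ger0_norm e0).
  have := ler_wpM2l e0 (hS (i + j)%N _); rewrite addnS leqnSn => /(_ isT).
  rewrite -/u; lra.
have -> : u + e *: G u - v - ((j%:R + 1) * e) *: G v =
    (u - v - (j%:R * e) *: G v) + e *: (G u - G v).
  by apply/rowP => l; rewrite !mxE; ring.
rewrite (le_trans (enormD _ _))// enormZ (ger0_norm e0).
have h3 := ler_wpM2l e0 (le_trans (Glip u v) (ler_wpM2l K0 h1)).
have h4 : 0 <= K * S * (j%:R * e * e) by rewrite !mulr_ge0.
have h5 : 0 <= K * S * (e * e) by rewrite !mulr_ge0.
rewrite (_ : ((j%:R + 1) * e) ^+ 2 = (j%:R * e) ^+ 2 + 2 * (j%:R * e * e) + e * e);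
  last by ring.
lra.
Qed.

(** Existence through Euler polygons: an ultrafilter limit of the polygons
    inherits their quadratic one-step error, hence solves the equation. *)
Lemma lipschitz_ode x : exists y : R -> 'rV[R]_n, y 0 = x /\
  forall b s t, 0 <= s -> s <= t -> t <= b ->
    let S := Lam * ((1 + enorm x) * expR (Lam * b)) in
    [/\ 1 + enorm (y t) <= (1 + enorm x) * expR (Lam * t),
        enorm (y t - y s) <= S * (t - s) &
        enorm (y t - y s - (t - s) *: G (y s)) <= K * S * (t - s) ^+ 2].
Proof.
pose e (m : nat) : R := m.+1%:R^-1.
have e0 m : 0 < e m by rewrite invr_gt0.
pose idx (m : nat) (t : R) := Num.truncn (t / e m).
pose z m t := euler (e m) x (idx m t).
have idx_le m t : 0 <= t -> (idx m t)%:R * e m <= t.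
  move=> t0; rewrite -ler_pdivlMr//.
  by have /andP[] := truncn_itv (divr_ge0 t0 (ltW (e0 m))).
have idx_gt m t : 0 <= t -> t < (idx m t)%:R * e m + e m.
  move=> t0; have /andP[_] := truncn_itv (divr_ge0 t0 (ltW (e0 m))).
  by rewrite ltr_pdivrMr// -/(idx m t) -natr1 mulrDl mul1r.
have zg m t : 0 <= t -> 1 + enorm (z m t) <= (1 + enorm x) * expR (Lam * t).
  move=> t0; apply: le_trans (euler_growth _ _ (ltW (e0 m))) _.
  by rewrite ler_wpM2l ?addr_ge0 ?enorm_ge0// ler_expR ler_wpM2l// idx_le.
have [U UU sU] := nat_ultrafilter.
have PU : ProperFilter U by exact: ultra_proper.
have FU : Filter U by exact: PU.
have ecvg : e @ U --> (0 : R).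
  apply: cvg_trans (@cvg_harmonic R); exact: cvg_app sU.
have zcvg t : cvg ((fun m => z m (Num.max 0 t)) @ U).
  apply: (@ultra_bounded_cvg _ _ _ _
    ((1 + enorm x) * expR (Lam * Num.max 0 t))) => m.
  have t0 : 0 <= Num.max 0 t by rewrite le_max lexx.
  by have := zg m _ t0; lra.
pose y t := lim ((fun m => z m (Num.max 0 t)) @ U).
have ycvg t : 0 <= t -> (fun m => z m t) @ U --> y t.
  move=> t0; have := zcvg t; rewrite /y.
  have -> : Num.max 0 t = t by apply/max_r.
  by [].
exists y; split.
  have h : (fun m => z m 0) @ U --> y 0 by exact: ycvg.
  have hx : (fun m => z m 0) @ U --> x.
    rewrite (_ : (fun m => _) = fun=> x); first exact: cvg_cst.
    by apply/funext => m; rewrite /z /idx mul0r truncn0.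
  exact: (cvg_unique (@norm_hausdorff _ _) h hx).
move=> b s t s0 st tb S; have t0 : 0 <= t by exact: le_trans st.
have S0 : 0 <= S by rewrite !mulr_ge0 ?addr_ge0 ?enorm_ge0 ?expR_ge0.
have zt := ycvg t t0; have zs := ycvg s s0.
have cdiff := @cvgB _ _ _ U FU _ _ _ _ zt zs.
have bound m : enorm (z m t - z m s) <= S * (t - s + e m) /\
    enorm (z m t - z m s - (t - s) *: G (z m s)) <=
      K * S * (t - s + e m) ^+ 2 + e m * S.
  have its : (idx m s <= idx m t)%N.
    by apply: le_truncn; rewrite ler_pM2r ?invr_gt0.
  have hS l : (l <= idx m s + (idx m t - idx m s))%N ->
      enorm (G (euler (e m) x l)) <= S.
    rewrite subnKC// => lt; apply: le_trans (Ggrowth _) _; rewrite ler_wpM2l//.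
    apply: le_trans (euler_growth _ _ (ltW (e0 m))) _.
    rewrite ler_wpM2l ?addr_ge0 ?enorm_ge0// ler_expR ler_wpM2l//.
    apply: le_trans tb; apply: le_trans (idx_le m t t0).
    by rewrite ler_pM2r// ler_nat.
  have := euler_increment (ltW (e0 m)) hS.
  rewrite subnKC// -/(z m t) -/(z m s) natrB// mulrBl => -[h1 h2].
  have i1 := idx_le m t t0; have i2 := idx_gt m t t0.
  have i3 := idx_le m s s0; have i4 := idx_gt m s s0.
  set T := (idx m t)%:R * e m in h1 h2 i1 i2 *.
  set T' := (idx m s)%:R * e m in h1 h2 i3 i4 *.
  have TT' : T' <= T by rewrite /T' /T ler_pM2r// ler_nat.
  have d1 : T - T' <= t - s + e m by lra.
  split; first by apply: le_trans h1 _; rewrite ler_wpM2l.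
  have -> : z m t - z m s - (t - s) *: G (z m s) =
    (z m t - z m s - (T - T') *: G (z m s)) + (T - T' - (t - s)) *: G (z m s).
    by apply/rowP => l; rewrite !mxE; ring.
  apply: le_trans (enormD _ _) _; rewrite enormZ; apply: lerD.
    apply: le_trans h2 _; apply: (ler_wpM2l (mulr_ge0 K0 S0)).
    by apply: lerXn2r; rewrite ?nnegrE ?subr_ge0//; lra.
  apply: ler_pM; rewrite ?normr_ge0 ?enorm_ge0//.
    by rewrite ler_norml; apply/andP; split; lra.
  by apply: (hS (idx m s)); rewrite leq_addr.
have tse : (fun m => t - s + e m) @ U --> t - s.
  rewrite -[X in _ --> X]addr0.
  by apply: (@cvgD _ _ _ U FU _ _ _ _ _ ecvg); exact: cvg_cst.
split.
- have c1 : (fun m => 1 + enorm (z m t)) @ U --> 1 + enorm (y t).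
    apply: (@cvgD _ _ _ U FU); [exact: cvg_cst|exact: (@enorm_cvg _ _ _ U FU)].
  have c2 : (fun=> (1 + enorm x) * expR (Lam * t)) @ U -->
      (1 + enorm x) * expR (Lam * t) by exact: cvg_cst.
  by apply: (filter_le_cvg PU c1 c2) => m; exact: zg.
- have c1 := @enorm_cvg _ _ _ U FU _ _ cdiff.
  have c2 : (fun m => S * (t - s + e m)) @ U --> S * (t - s).
    by apply: (@cvgM _ _ U FU _ _ _ _ _ tse); exact: cvg_cst.
  by apply: (filter_le_cvg PU c1 c2) => m; have [] := bound m.
have Gc : (fun m => G (z m s)) @ U --> G (y s).
  apply/cvg_enormP => r r0; have r'0 : 0 < r / (K + 1) by rewrite divr_gt0// ltr_wpDl.
  have := (cvg_enormP (FG := FU) _ _).1 zs _ r'0; apply: filterS => m hm.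
  apply: le_lt_trans (Glip _ _) _.
  have : (K + 1) * enorm (z m s - y s) < r by rewrite mulrC -ltr_pdivlMr// ltr_wpDl.
  by have := enorm_ge0 (z m s - y s); lra.
have c1 : (fun m => z m t - z m s - (t - s) *: G (z m s)) @ U -->
    y t - y s - (t - s) *: G (y s).
  apply: (@cvgB _ _ _ U FU _ _ _ _ cdiff).
  by apply: (@cvgZ _ _ _ U FU _ _ _ _ _ Gc); exact: cvg_cst.
have c2 : (fun m => K * S * (t - s + e m) ^+ 2 + e m * S) @ U -->
    K * S * (t - s) ^+ 2 + 0 * S.
  apply: (@cvgD _ _ _ U FU).
    apply: (@cvgM _ _ U FU); [exact: cvg_cst|exact: (@cvgM _ _ U FU _ _ _ _ tse tse)].
  by apply: (@cvgM _ _ U FU _ _ _ _ ecvg); exact: cvg_cst.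
rewrite mul0r addr0 in c2.
have c3 := @enorm_cvg _ _ _ U FU _ _ c1.
by apply: (filter_le_cvg PU c3 c2) => m; have [] := bound m.
Qed.

End LipschitzODE.

(** * Realising feedback arcs by trajectories *)

Section TameTrajectories.
Context {R : realType} {n : nat}.
Variable F : 'rV[R]_n -> set 'rV[R]_n.
Variables L c0 K Lam : R.
Hypothesis hF : regular_inclusion F L c0 K Lam.
Let K0 := ri_K0 hF.
Let Lam0 := ri_Lam0 hF.
Implicit Types (x z p : 'rV[R]_n) (y : R -> 'rV[R]_n).

(** Trajectories whose exceptional times form a finite list; unlike general
    ones, they are easy to concatenate. *)
Definition tame_trajectory x y : Prop :=
  [/\ y 0 = x,
      forall b, 0 <= b -> exists2 A, 0 <= A & forall s t, 0 <= s -> s <= t ->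
        t <= b -> enorm (y t - y s) <= A * (t - s) &
      exists E : seq R, forall t, 0 < t -> t \notin E ->
        derivable y t 1 /\ F (y t) (derive1 y t)].

Lemma tame_is_trajectory x y : tame_trajectory x y -> trajectory F x y.
Proof.
move=> [y0 lip [E hE]]; split=> //.
  move=> b b0 e e0; have [A A0 hA] := lip b b0.
  have A1 : 0 < A + 1 by rewrite ltr_wpDl.
  exists (e / (A + 1)) => [|k s t st _ len]; first by rewrite divr_gt0.
  rewrite ltr_pdivlMr// mulrC in len.
  apply: le_lt_trans len; rewrite mulr_sumr ler_sum// => i _.
  have [s0 sti tb] := st i.
  apply: le_trans (hA _ _ s0 sti tb) _.
  by rewrite ler_wpM2r ?subr_ge0// lerDl.
have cE : countable [set` 0 :: E] by exact: finite_set_countable.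
have : (@lebesgue_measure R).-negligible [set` 0 :: E].
  exists [set` 0 :: E]; split=> //; first exact: countable_measurable.
  exact: countable_lebesgue_measure0.
apply: negligibleS => t /= nt.
case: (boolP (t \in 0 :: E)) => // tE; exfalso; apply: nt => t0.
move: tE; rewrite inE negb_or => /andP[tn0 tE].
by apply: hE => //; rewrite lt_neqAle eq_sym tn0.
Qed.

Lemma tame_concat x y1 y2 a : 0 < a -> tame_trajectory x y1 ->
  tame_trajectory (y1 a) y2 ->
  tame_trajectory x (fun t => if t <= a then y1 t else y2 (t - a)).
Proof.
move=> a0 [y10 lip1 [E1 hE1]] [y20 lip2 [E2 hE2]]; split.
- by rewrite (ltW a0).
- move=> b b0; have [A1 A10 h1] := lip1 b b0; have [A2 A20 h2] := lip2 b b0.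
  exists (A1 + A2) => [|s t s0 st tb]; first by rewrite addr_ge0.
  have ts0 : 0 <= t - s by rewrite subr_ge0.
  have w1 := mulr_ge0 A10 ts0; have w2 := mulr_ge0 A20 ts0.
  case: (leP t a) => ta; case: (leP s a) => sa.
  + by apply: le_trans (h1 _ _ s0 st tb) _; rewrite mulrDl lerDl.
  + by move: (lt_le_trans sa st); rewrite ltNge ta.
  + have k1 := h1 s a s0 sa (le_trans (ltW ta) tb).
    have k2 : enorm (y2 (t - a) - y2 0) <= A2 * (t - a - 0).
      by apply: h2; rewrite ?subr_ge0//; lra.
    have := enorm_triangle (y1 a) (y2 (t - a)) (y1 s); rewrite -{1}y20.
    have l1 : A2 * (t - a) <= A2 * (t - s) by rewrite ler_wpM2l// lerB.
    have l2 : A1 * (a - s) <= A1 * (t - s) by rewrite ler_wpM2l// lerB// ltW.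
    rewrite subr0 in k2; lra.
  + have k2 : enorm (y2 (t - a) - y2 (s - a)) <= A2 * (t - a - (s - a)).
      by apply: h2; rewrite ?subr_ge0 ?lerD2r//; lra.
    have E : t - a - (s - a) = t - s by ring.
    by apply: le_trans k2 _; rewrite E mulrDl lerDr.
exists (a :: E1 ++ [seq u + a | u <- E2]) => t t0.
rewrite in_cons mem_cat !negb_or => /and3P[ta tE1 tE2].
set w := fun t => _.
(* away from [a], the concatenation is locally one of the two pieces *)
have transfer (y : R -> 'rV[R]_n) : (\forall s \near t, w s = y s) ->
    derivable y t 1 -> derivable w t 1 /\ derive1 w t = derive1 y t.
  move=> wy dy; have yw : {near t, y =1 w} by apply: filterS wy.
  split; first exact: (near_eq_derivable yw dy).
  by rewrite !derive1E; apply: near_eq_derive.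
have [lta|gta|eta] := ltgtP t a; last by rewrite eta eqxx in ta.
  have [d1 F1] := hE1 t t0 tE1.
  have near_w : \forall s \near t, w s = y1 s.
    have : \forall s \near t, s < a by exact: lt_nbhsl.
    by apply: filterS => s sa; rewrite /w (ltW sa).
  have [dw ->] := transfer y1 near_w d1.
  by split; [exact: dw|exact: F1].
have ta0 : 0 < t - a by rewrite subr_gt0.
have tE2' : t - a \notin E2.
  by apply: contra tE2 => h; apply/mapP; exists (t - a); rewrite ?subrK.
have [d2 F2] := hE2 _ ta0 tE2'.
have shiftE : (fun h : R => h^-1 *: (y2 (h *: 1 + t - a) - y2 (t - a))) =
    (fun h : R => h^-1 *: (y2 (h *: 1 + (t - a)) - y2 (t - a))).
  by apply/funext => h; rewrite addrA.
have d2s : derivable (fun s => y2 (s - a)) t 1.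
  by rewrite /derivable/= shiftE; exact: d2.
have D2s : derive1 (fun s => y2 (s - a)) t = derive1 y2 (t - a).
  by rewrite !derive1E /derive/= shiftE.
have near_w : \forall s \near t, w s = y2 (s - a).
  have : \forall s \near t, a < s by exact: lt_nbhsr.
  by apply: filterS => s sa; rewrite /w leNgt sa.
have [dw ->] := transfer (fun s => y2 (s - a)) near_w d2s.
split; first exact: dw.
by rewrite D2s.
Qed.

Lemma euler_arc_lipschitz (eta : R) ps u v : 0 <= eta ->
  all (fun p => p != 0) ps ->
  enorm (euler_arc F eta ps u - euler_arc F eta ps v) <=
    (1 + eta * K) ^+ size ps * enorm (u - v).
Proof.
move=> eta0; elim: ps u v => [|p ps IH] u v /=; first by rewrite mul1r.
move=> /andP[p0 ps0]; apply: le_trans (IH _ _ ps0) _.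
rewrite exprSr -mulrA ler_wpM2l ?exprn_ge0 ?addr_ge0 ?mulr_ge0//.
have -> : u + eta *: velocity F u p - (v + eta *: velocity F v p) =
    (u - v) + eta *: (velocity F u p - velocity F v p).
  by apply/rowP => i; rewrite !mxE; ring.
apply: le_trans (enormD _ _) _; rewrite enormZ (ger0_norm eta0) mulrDl mul1r.
by rewrite lerD2l -mulrA ler_wpM2l// (velocity_lipschitz hF).
Qed.

(** Following the feedbacks [velocity F ^~ p] in turn is an Euler step up to an
    error of second order, and the errors do not amplify. *)
Lemma euler_arc_tracking (A eta : R) p ps z : 0 < eta ->
  all (fun p => p != 0) (p :: ps) ->
  Lam * ((1 + enorm z) * expR (Lam * ((size ps).+1%:R * eta))) <= A ->
  exists2 w, tame_trajectory z w &
    enorm (w ((size ps).+1%:R * eta) - euler_arc F eta (p :: ps) z) <=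
      (1 + eta * K) ^+ (size ps).+1 * ((size ps).+1%:R * (K * A * eta ^+ 2)).
Proof.
move=> eta0; have eta0' := ltW eta0.
have K1 : 1 <= 1 + eta * K by rewrite lerDl mulr_ge0.
have step q u A' : q != 0 -> Lam * ((1 + enorm u) * expR (Lam * eta)) <= A' ->
    exists y, [/\ tame_trajectory u y,
      1 + enorm (y eta) <= (1 + enorm u) * expR (Lam * eta) &
      enorm (y eta - (u + eta *: velocity F u q)) <= K * A' * eta ^+ 2].
  move=> q0 uA.
  have Gl v w : enorm (velocity F v q - velocity F w q) <= K * enorm (v - w).
    by exact: (velocity_lipschitz hF).
  have Gg v : enorm (velocity F v q) <= Lam * (1 + enorm v).
    by apply: (ri_growth hF); have [] := velocity_spec hF v q0.
  have [y [y0 hy]] := lipschitz_ode K0 Lam0 Gl Gg u.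
  exists y; split.
  - split=> //.
      move=> b b0; exists (Lam * ((1 + enorm u) * expR (Lam * b))).
        by rewrite !mulr_ge0 ?addr_ge0 ?enorm_ge0 ?expR_ge0.
      by move=> s t s0 st tb; have [] := hy b s t s0 st tb.
    exists [::] => t t0 _.
    set S := Lam * ((1 + enorm u) * expR (Lam * (t + 1))).
    have S0 : 0 <= S by rewrite !mulr_ge0 ?addr_ge0 ?enorm_ge0 ?expR_ge0.
    have KS0 : 0 <= K * S by rewrite mulr_ge0.
    have m0 : 0 < Num.min t 1 by rewrite lt_min t0 ltr01.
    have [|dy ->] := @derive1_quadratic R n y t (velocity F (y t) q)
        (2 * (K * S)) _ m0.
      move=> h; rewrite lt_min => /andP[ht h1].
      have [h0|h0] := leP 0 h.
        have ht0 : t <= h + t by lra.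
        have t1 : h + t <= t + 1 by have := ler_norm h; lra.
        have [_ _] := hy (t + 1) t (h + t) (ltW t0) ht0 t1.
        rewrite addrK -/S => /le_trans; apply.
        by rewrite ler_wpM2r ?sqr_ge0//; lra.
      have th : 0 <= h + t by rewrite ltr0_norm// in ht; lra.
      have ht0 : h + t <= t by lra.
      have t1 : t <= t + 1 by lra.
      have [_ e1 e2] := hy (t + 1) (h + t) t th ht0 t1.
      have Eh : t - (h + t) = - h by ring.
      rewrite -/S Eh in e1 e2.
      rewrite -enormN; set v1 := velocity F (y t) q.
      have -> : - (y (h + t) - y t - h *: v1) =
          (y t - y (h + t) - - h *: velocity F (y (h + t)) q) +
          h *: (v1 - velocity F (y (h + t)) q).
        by apply/rowP => i; rewrite !mxE; ring.
      apply: le_trans (enormD _ _) _; rewrite enormZ ltr0_norm//.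
      have nh0 : 0 <= - h by lra.
      have e3 := ler_wpM2l nh0 (le_trans (Gl (y t) (y (h + t))) (ler_wpM2l K0 e1)).
      rewrite -/v1 in e3; rewrite sqrrN in e2; lra.
    by split=> //; have [] := velocity_spec hF (y t) q0.
  - have [+ _ _] := hy eta 0 eta (lexx 0) eta0' (lexx eta); exact.
  - have [_ _] := hy eta 0 eta (lexx 0) eta0' (lexx eta).
    rewrite subr0 y0 opprD addrA => /le_trans; apply.
    by rewrite ler_wpM2r ?sqr_ge0// ler_wpM2l.
have A0 (q : 'rV[R]_n) (m : nat) : Lam * ((1 + enorm q) * expR (Lam * (m%:R * eta))) <= A ->
    0 <= K * A * eta ^+ 2.
  move=> qA; rewrite !mulr_ge0 ?sqr_ge0//; apply: le_trans qA.
  by rewrite !mulr_ge0 ?addr_ge0 ?enorm_ge0 ?expR_ge0.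
elim: ps p z => [|p' ps IH] p z /andP[p0 ps0] zA.
  have [|w [wt _ werr]] := step p z A p0; first by rewrite mul1r in zA.
  exists w => //=; rewrite !mul1r; apply: le_trans werr _.
  by rewrite ler_peMl ?expr1// (A0 z 1%N).
have [|y [yt yg yerr]] := step p z A p0.
  apply: le_trans zA; rewrite ler_wpM2l// ler_wpM2l ?addr_ge0 ?enorm_ge0//.
  by rewrite ler_expR ler_wpM2l// ler_peMl// ler1n.
have [|w2 w2t w2err] := IH p' (y eta) ps0.
  apply: le_trans zA; rewrite ler_wpM2l//.
  apply: le_trans (ler_wpM2r (expR_ge0 _) yg) _.
  rewrite -mulrA -expRD ler_wpM2l ?addr_ge0 ?enorm_ge0// ler_expR -mulrDr.
  by rewrite /= -[in leRHS]natr1 mulrDl mul1r addrC.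
exists (fun t => if t <= eta then y t else w2 (t - eta)).
  exact: tame_concat eta0 yt w2t.
have -> : ((size (p' :: ps)).+1%:R * eta <= eta) = false.
  apply/negbTE; rewrite -ltNge ltr_pMl// ltr1n//.
have -> : (size (p' :: ps)).+1%:R * eta - eta = (size ps).+1%:R * eta.
  by rewrite /= -natr1; ring.
have -> : euler_arc F eta [:: p, p' & ps] z =
    euler_arc F eta (p' :: ps) (z + eta *: velocity F z p) by [].
apply: le_trans (enorm_triangle (euler_arc F eta (p' :: ps) (y eta)) _ _) _.
have h1 := @euler_arc_lipschitz eta (p' :: ps) (y eta) (z + eta *: velocity F z p)
  eta0' ps0.
have K1n : 0 <= (1 + eta * K) ^+ (size ps).+1.
  by rewrite exprn_ge0 ?addr_ge0 ?mulr_ge0.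
have h2 := le_trans h1 (ler_wpM2l K1n yerr).
have h3 := A0 z _ zA.
have h4 : (1 + eta * K) ^+ (size ps).+1 <= (1 + eta * K) ^+ (size ps).+2.
  by rewrite [leRHS]exprS ler_peMl.
have h5 : 0 <= (size ps).+2%:R * (K * A * eta ^+ 2) by rewrite mulr_ge0.
have h6 := ler_wpM2r h5 h4.
have collect (a1 a2 P1 P2 m X : R) : a1 <= P1 * (m * X) -> a2 <= P1 * X ->
    P1 * ((m + 1) * X) <= P2 * ((m + 1) * X) -> a1 + a2 <= P2 * ((m + 1) * X).
  by clear; move=> *; lra.
rewrite -[(size ps).+2%:R]natr1 in h6.
rewrite -[(size (p' :: ps)).+1%:R]natr1.
exact: (collect _ _ _ _ _ _ w2err h2 h6).
Qed.

End TameTrajectories.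

(** * Approximate exterior normals from discrete optimal arcs *)

(** A proximal normal [v] to the closure of the complement, realised by a ball of
    radius [rho0], says that the ball centred at [x + rho0 v / |v|] misses the
    complement. *)
Lemma inner_ball_center (R : realType) n (S : set 'rV[R]_n) rho0 x :
  0 < rho0 -> inner_ball_property S rho0 -> boundary S x ->
  exists2 c, enorm (x - c) = rho0 & forall w, enorm (w - c) < rho0 -> S w.
Proof.
move=> rho00 inner bx; have [v [v0 _ hv]] := inner x bx.
have v1 : 0 < enorm v by rewrite enorm_gt0.
pose a := rho0 / enorm v; have a0 : 0 < a by rewrite divr_gt0.
have av : a * enorm v = rho0 by rewrite divfK// gt_eqF.
exists (x + a *: v).
  by rewrite opprD addNKr enormN enormZ gtr0_norm.
move=> w wc; apply: contrapT => nSw.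
have {}hv := hv w (subset_closure nSw).
move: wc; rewrite ltNge => /negP; apply.
have -> : w - (x + a *: v) = (w - x) - a *: v by rewrite opprD addrA.
rewrite -(@ler_pXn2r _ 2)// ?nnegrE ?enorm_ge0 ?(ltW rho00)//.
rewrite enorm_sqrB dotZr enormZ (gtr0_norm a0) av (dotC _ v) lerDr subr_ge0.
have h1 := ler_wpM2l (ltW a0) hv; rewrite !mulrA av in h1.
have h2 : rho0 / (2 * rho0) = 2^-1 by field; rewrite gt_eqF.
rewrite h2 in h1; lra.
Qed.

Lemma exp_bound_below (R : realType) (a : R) k : 0 <= a -> 2 * a <= 1 ->
  expR (- (2 * (k%:R * a))) <= (1 - a) ^+ k.
Proof.
move=> a0 a1.
have h : expR (- (2 * a)) <= 1 - a.
  rewrite expRN invf_ple ?posrE ?expR_gt0//; last lra.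
  apply: le_trans (expR_ge1Dx _); rewrite -div1r ler_pdivrMr; last lra.
  have : 0 <= a * (1 - 2 * a) by rewrite mulr_ge0// subr_ge0.
  lra.
have -> : - (2 * (k%:R * a)) = k%:R * - (2 * a) by ring.
rewrite expRM_natl; apply: lerXn2r; rewrite ?nnegrE ?expR_ge0//; lra.
Qed.

Lemma minimum_time_le_hit (R : realType) n (F : 'rV[R]_n -> set 'rV[R]_n) S z w
    (b t : R) : trajectory F z w -> (b%:E <= minimum_time F S z)%E ->
  0 <= t -> S (w t) -> b <= t.
Proof.
move=> tw bz t0 St; rewrite -lee_fin; apply: le_trans bz _.
apply: (@le_trans _ _ (transition_time S w)).
  by apply: ereal_inf_lbound; exists w.
by apply: ereal_inf_lbound; exists t.
Qed.

Section ApproximateNormal.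
Context {R : realType} {n : nat}.
Variable F : 'rV[R]_n -> set 'rV[R]_n.
Variables L c0 K Lam : R.
Hypothesis hF : regular_inclusion F L c0 K Lam.
Variables (S : set 'rV[R]_n) (rho0 : R).
Hypothesis cS : closed S.
Hypothesis rho00 : 0 < rho0.
Hypothesis inner : inner_ball_property S rho0.
Let L0 := ri_L0 hF.
Let c00 := ri_c0 hF.
Let K0 := ri_K0 hF.
Let Lam0 := ri_Lam0 hF.
Implicit Types (x z p c : 'rV[R]_n).

(** Dropping the last step of an optimal arc costs at most its length. *)
Lemma value_step h c k x A : 0 <= h ->
  Lam * ((1 + enorm x) * (1 + h * Lam) ^+ k) <= A ->
  value F h c k x <= value F h c k.+1 x + h * A.
Proof.
move=> h0; have hL0 : 0 <= h * Lam by rewrite mulr_ge0.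
have hL1 : 0 <= 1 + h * Lam by rewrite addr_ge0.
elim: k x => [|k IH] x xA.
  have [f Ff fv] := (value_regular hF c 0 h0).2 x.
  rewrite -fv /=.
  have := enorm_triangle (x + h *: f) x c.
  rewrite opprD addNKr enormN enormZ (ger0_norm h0).
  have := ler_wpM2l h0 (le_trans (ri_growth hF Ff) _ : enorm f <= A).
  rewrite expr0 mulr1 in xA; move=> /(_ xA); lra.
have [f Ff fv] := (value_regular hF c k.+1 h0).2 x.
rewrite -fv; apply: le_trans (value_le hF h c k Ff) _; apply: IH.
apply: le_trans xA; rewrite ler_wpM2l// exprS mulrA ler_wpM2r ?exprn_ge0//.
have := enormD x (h *: f); rewrite enormZ (ger0_norm h0).
have := ler_wpM2l h0 (ri_growth hF Ff); lra.
Qed.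

Lemma value_ge_dist h c k x A : 0 <= h ->
  Lam * ((1 + enorm x) * (1 + h * Lam) ^+ k) <= A ->
  enorm (x - c) <= value F h c k x + k%:R * (h * A).
Proof.
move=> h0; have hL0 : 0 <= h * Lam by rewrite mulr_ge0.
elim: k => [|k IH] xA; first by rewrite mul0r addr0.
have {}xA : Lam * ((1 + enorm x) * (1 + h * Lam) ^+ k) <= A.
  apply: le_trans xA; rewrite ler_wpM2l// ler_wpM2l ?addr_ge0 ?enorm_ge0//.
  by rewrite exprS ler_peMl ?exprn_ge0 ?addr_ge0// lerDl.
have := IH xA; have := value_step c h0 xA; rewrite -[k.+1%:R]natr1.
move: (value _ _ _ _ _) (value _ _ _ _ _) => *; lra.
Qed.

(** The constants below depend on the point only through a bound [M] on its norm
    and on its minimum time. The extra unit of time leaves room on both sides of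
    the minimum time. *)
Definition horizon (M : R) := M + 1.
Definition speed_bound (M : R) :=
  Lam * ((1 + M) * expR (Lam * horizon M)) + 1.
(** Bounds of the discrete adjoint vectors, from
    [(1 - 2 L h)^k <= |p| <= (1 + 2 L h)^k]; they exclude that the normal
    degenerates in the limit. *)
Definition adjoint_bound (M : R) := expR (2 * L * horizon M).
Definition adjoint_floor (M : R) := expR (- (4 * L * horizon M)).
Definition curvature (M : R) :=
  expR (curvature_rate K (horizon M) (speed_bound M)) *
    (rho0^-1 + (L + horizon M * c0) * adjoint_bound M).

(** Before the minimum time a trajectory stays outside [S], hence outside the
    ball; continuity extends this to the minimum time itself. *)
Lemma outside_ball_before z w c (b : R) : trajectory F z w -> ~ S z -> 0 <= b ->
  (b%:E <= minimum_time F S z)%E -> (forall u, enorm (u - c) < rho0 -> S u) ->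
  rho0 <= enorm (w b - c).
Proof.
move=> tw nSz b0 bz ball; rewrite leNgt; apply/negP => wc.
have w0 : w 0 = z by case: tw.
have [b00|bpos] := eqVneq b 0.
  by apply: nSz; rewrite -w0; apply: ball; rewrite -{1}b00.
have {}bpos : 0 < b by rewrite lt_neqAle eq_sym bpos.
have g0 : 0 < rho0 - enorm (w b - c) by rewrite subr_gt0.
have [d d0 hd] := trajectory_continuous tw b0 g0.
pose t := Num.max 0 (b - d / 2).
have d2 : 0 < d / 2 by rewrite divr_gt0.
have t0 : 0 <= t by rewrite le_max lexx.
have tb : t < b by rewrite gt_max bpos/= ltrBlDr ltrDl.
have bt : b - d / 2 <= t by rewrite le_max lexx orbT.
have := hd t b t0 (ltW tb) (lexx b); rewrite enormBC => hd'.
have {}hd' : enorm (w t - w b) < rho0 - enorm (w b - c) by apply: hd'; lra.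
have St : S (w t).
  apply: ball; apply: le_lt_trans (enorm_triangle (w b) _ _) _; lra.
by have := minimum_time_le_hit tw bz t0 St; rewrite leNgt tb.
Qed.

(** The target is replaced by a ball of radius [rho0] contained in it and touched
    by an almost optimal trajectory. The discrete arcs are stopped at the first
    step [k.+1] where the ball, enlarged by [e'], can be reached: one step earlier
    it could not, so the optimal distance is close to [rho0] and
    [discrete_semiconcavity] applies with curvature [1 / rho0]. The resulting
    bound on [euler_arc] is compared with the fact that the nearby trajectory
    given by [euler_arc_tracking] is outside the ball up to time [b]. The time
    [theta] is bounded below because [x] is at positive distance from [S]. *)
Lemma approximate_normal M x (T0 : R) : ~ S x -> minimum_time F S x = T0%:E ->
  enorm x <= M -> T0 <= M -> exists2 tau, 0 < tau & forall e, 0 < e -> e <= 1 ->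
  exists p q theta,
    [/\ tau <= theta < T0 + e,
        adjoint_floor M <= enorm p <= adjoint_bound M,
        `|q| <= speed_bound M * adjoint_bound M &
        forall z b, ~ S z -> 0 <= b <= horizon M ->
          (b%:E <= minimum_time F S z)%E ->
          dot p (z - x) + q * (b - theta) <=
            curvature M * (enorm (z - x) ^+ 2 + (b - theta) ^+ 2) +
            e * (1 + expR (K * horizon M) * (horizon M *
              (K * (Lam * ((1 + enorm z) * expR (Lam * horizon M))))))].
Proof.
move=> nSx Tx xM TM.
have [rho0p Lp Kp] := And3 rho00 L0 K0.
set B := horizon M; set A := speed_bound M.
have M0 : 0 <= M := le_trans (enorm_ge0 x) xM.
have B1 : 1 <= B by rewrite /B /horizon lerDr.
have B0 : 0 < B by lra.
have [dl dl0 hdl] := open_enorm_ball (closed_openC cS) nSx.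
have A1 : 1 <= A.
  by rewrite /A /speed_bound lerDr !mulr_ge0 ?addr_ge0 ?expR_ge0.
have A0 : 0 < A by lra.
pose tau := dl / (2 * A).
have tau0 : 0 < tau by rewrite divr_gt0// mulr_gt0.
exists tau => // e e0 e1.
have : (minimum_time F S x < (T0 + e)%:E)%E by rewrite Tx lte_fin ltrDl.
move=> /ereal_inf_lt[_ [y ty <-]] /ereal_inf_lt[_ [t1 [t10 St1] <-]].
rewrite lte_fin => t1e.
have [th [/andP[th0 tht1] Sth _ clth]] := first_hitting_time ty cS nSx t10 St1.
have thB : th <= B by rewrite /B /horizon; lra.
have [|c yc ball] := inner_ball_center (x := y th) rho00 inner.
  split; first exact: subset_closure.
  by move=> iS; have [w [nSw Sw]] := clth _ iS.
have xc : rho0 + dl <= enorm (x - c).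
  set D := enorm (x - c); rewrite leNgt; apply/negP => Dlt.
  have D_ge : rho0 <= D by rewrite leNgt; apply/negP => /ball.
  have D0 : 0 < D by exact: lt_le_trans D_ge.
  have DN : D != 0 by rewrite gt_eqF.
  (* otherwise the point at distance [t] from [x] towards [c] lies in both balls *)
  pose m := Num.min dl D; pose t := (D - rho0 + m) / 2.
  have Dm : D - rho0 < m by rewrite lt_min; apply/andP; split; lra.
  have m_dl : m <= dl by rewrite ge_min lexx.
  have m_D : m <= D by rewrite ge_min lexx orbT.
  pose w := x + (t / D) *: (c - x).
  have Et : t = t / D * D by rewrite divfK.
  have t0 : 0 <= t / D by rewrite divr_ge0 ?(ltW D0)// /t; lra.
  have tD1 : 0 <= 1 - t / D by rewrite subr_ge0 ler_pdivrMr// /t; lra.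
  apply: (hdl w).
    rewrite /w addrC addKr enormZ ger0_norm// enormBC -/D -Et /t; lra.
  apply: ball.
  have -> : w - c = (1 - t / D) *: (x - c).
    by apply/rowP => i; rewrite !mxE; ring.
  rewrite enormZ ger0_norm// -/D mulrBl -Et /t; lra.
have [Ay Ay0 hAy] := trajectory_bounded hF ty (ltW th0).
(* [C] is the tracking constant; [h0] makes the tracking error at most [e'], one
   step at most half the radius, the adjoint factors at least [1 / 2], and the
   step of the comparison arcs at most [e] *)
pose C := expR (L * th) * (L * Ay * th).
have C0 : 0 <= C by rewrite !mulr_ge0 ?expR_ge0// ltW.
pose e' := Num.min e (dl / 2).
have e'0 : 0 < e' by rewrite lt_min e0 divr_gt0.
have e'e : e' <= e by rewrite ge_min lexx.
have e'dl : e' <= dl / 2 by rewrite ge_min lexx orbT.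
pose h0 := Num.min (Num.min (e' / (C + 1)) (rho0 / (2 * A)))
  (Num.min ((4 * (L + 1))^-1) (e * tau / B)).
have h00 : 0 < h0.
  have C1 : 0 < C + 1 by rewrite ltr_wpDl.
  have L1 : 0 < L + 1 by rewrite ltr_wpDl.
  have a1 : 0 < e' / (C + 1) by rewrite divr_gt0.
  have a2 : 0 < rho0 / (2 * A) by rewrite divr_gt0// mulr_gt0.
  have a3 : 0 < (4 * (L + 1))^-1 by rewrite invr_gt0 mulr_gt0.
  have a4 : 0 < e * tau / B by rewrite divr_gt0// mulr_gt0.
  by rewrite !lt_min a1 a2 a3 a4.
pose N := Num.truncn (th / h0).
pose h := th / N.+1%:R.
have hgt0 : 0 < h by rewrite divr_gt0.
have hh0 : h <= h0.
  rewrite ler_pdivrMr// mulrC -ler_pdivrMr// ltW//.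
  by have /andP[] := truncn_itv (divr_ge0 (ltW th0) (ltW h00)).
have [hC hA hL hT] : [/\ C * h <= e', h * A <= rho0 / 2, 4 * L * h <= 1 &
    h * B <= e * tau].
  move: hh0; rewrite !le_min -andbA => /and4P[k1 k2 k3 k4].
  have C1 : 0 < C + 1 by rewrite ltr_wpDl.
  have L1 : 0 < 4 * (L + 1) by rewrite mulr_gt0// ltr_wpDl.
  have A2 : 0 < 2 * A by rewrite mulr_gt0.
  rewrite ler_pdivlMr// in k1; rewrite ler_pdivlMr// in k2.
  rewrite -div1r ler_pdivlMr// in k3; rewrite ler_pdivlMr// in k4.
  split=> //; rewrite ?mulrDr ?mulr1 in k1 k3.
  - have := mulrC C h; lra.
  - lra.
  - lra.
have hN : h * N.+1%:R = th by rewrite divfK// gt_eqF.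
have growth_k k : (k <= N.+1)%N ->
    Lam * ((1 + enorm x) * (1 + h * Lam) ^+ k) <= A.
  move=> kN; have kh : k%:R * h <= B.
    by apply: le_trans thB; rewrite -hN mulrC ler_pM2l// ler_nat.
  rewrite /A /speed_bound -/B.
  apply: (@le_trans _ _ (Lam * ((1 + M) * expR (Lam * B)))); last first.
    by rewrite lerDl.
  rewrite ler_wpM2l// ler_pM ?addr_ge0 ?enorm_ge0 ?exprn_ge0 ?addr_ge0 ?mulr_ge0//.
  - by rewrite ltW.
  - by rewrite lerD2l.
  apply: le_trans (exp_bound _ (mulr_ge0 (ltW hgt0) Lam0)) _.
  by rewrite ler_expR mulrA mulrC ler_wpM2l.
have vN : value F h c N.+1 x <= rho0 + e'.
  have := value_tracking hF ty c th0 Ay0 hAy (erefl h).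
  by rewrite yc -/C => /le_trans; apply; rewrite lerD2l.
have exk : exists k, value F h c k x <= rho0 + e' by exists N.+1.
case: (ex_minnP exk) => -[|k] vk kmin.
  by move: vk => /=; lra.
have kN : (k < N.+1)%N by exact: kmin.
have vr : rho0 / 2 <= value F h c k.+1 x.
  have vk' : rho0 + e' < value F h c k x.
    by rewrite ltNge; apply/negP => /kmin; rewrite ltnn.
  have := value_step c (ltW hgt0) (growth_k k (ltnW kN)); lra.
have kh_tau : tau <= k.+1%:R * h.
  have := value_ge_dist c (ltW hgt0) (growth_k k.+1 kN) => vx.
  rewrite /tau ler_pdivrMr ?mulr_gt0//; lra.
set m : R := k.+1%:R in kh_tau *.
have m1 : 1 <= m by rewrite ler1n.
have m0 : 0 < m by lra.
have kh_th : m * h <= th by rewrite -hN mulrC ler_pM2l// ler_nat.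
have mm : m / m = 1 by rewrite divff// gt_eqF.
have hP : (1 + 2 * L * h) ^+ k.+1 <= adjoint_bound M.
  have Lh : 0 <= 2 * L * h by rewrite !mulr_ge0// ltW.
  apply: le_trans (exp_bound _ Lh) _; rewrite ler_expR -/m.
  have -> : m * (2 * L * h) = 2 * L * (m * h) by ring.
  by rewrite ler_wpM2l ?mulr_ge0// (le_trans kh_th).
have [|||ps [p [q [sps ps0 /andP[pl pu] qb main]]]] :=
  @discrete_semiconcavity R n F L c0 K Lam hF B A (adjoint_bound M)
    (rho0 / 2) m h c k.+1 x _ m1 hgt0 _ _ (ltW B0) vr (growth_k _ kN) hP.
- by rewrite divr_gt0.
- by rewrite mulrC; lra.
- lra.
exists p, q, (m * h); split.
- by rewrite kh_tau; lra.
- rewrite (le_trans pu hP) andbT; apply: le_trans pl.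
  have Lh : 0 <= 2 * L * h by rewrite !mulr_ge0// ltW.
  apply: le_trans (exp_bound_below _ Lh _); last lra.
  rewrite ler_expR lerN2 -/m.
  have -> : 2 * (m * (2 * L * h)) = 4 * L * (m * h) by ring.
  by rewrite ler_wpM2l ?mulr_ge0// (le_trans kh_th).
- by rewrite mm mul1r in qb.
move=> z b nSz /andP[b0 bB] bz.
have etab : b / m * m = b by rewrite divfK// gt_eqF.
have := main z (b / m) (divr_ge0 b0 (ltW m0)); rewrite etab => /(_ bB).
rewrite mulrBr (mulrC m) etab.
set sq := enorm (z - x) ^+ 2 + _; set Az := Lam * ((1 + enorm z) * _).
move=> ub.
have curv : curvature_bound L c0 K B A (adjoint_bound M) (rho0 / 2) m k.+1 <= curvature M.
  rewrite /curvature_bound -/m mm mul1r /curvature -/A -/B.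
  have -> : 2 * (rho0 / 2) = rho0 by field.
  have g0 : 0 <= curvature_rate K B A.
    have BK0 : 0 <= B * K by rewrite mulr_ge0// ltW.
    have A0' := ltW A0.
    by rewrite /curvature_rate addr_ge0 ?sqr_ge0// addr_ge0// mulr_ge0// addr_ge0.
  rewrite ler_wpM2r//.
    rewrite addr_ge0 ?invr_ge0 ?(ltW rho00)// mulr_ge0 ?expR_ge0//.
    by rewrite addr_ge0// mulr_ge0// ltW.
  have gm : 0 <= curvature_rate K B A / m by rewrite divr_ge0// ltW.
  have Eg : m * (curvature_rate K B A / m) = curvature_rate K B A.
    by rewrite mulrC divfK// gt_eqF.
  by have := exp_bound k.+1 gm; rewrite -/m Eg.
have lb : rho0 - e * (expR (K * B) * (B * (K * Az))) <=
    enorm (euler_arc F (b / m) ps z - c).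
  have Az0 : 0 <= Az by rewrite !mulr_ge0 ?addr_ge0 ?enorm_ge0 ?expR_ge0.
  have err0 : 0 <= e * (expR (K * B) * (B * (K * Az))).
    by rewrite mulr_ge0 ?(ltW e0)// mulr_ge0 ?expR_ge0// mulr_ge0 ?(ltW B0)// mulr_ge0.
  have [b00|bN] := eqVneq b 0.
    (* the case [b = 0] has zero step, and the arc does not move *)
    have arc0 qs u : euler_arc F 0 qs u = u.
      by elim: qs u => [//|a qs IH] u; rewrite /= scale0r addr0.
    have zc : rho0 <= enorm (z - c) by rewrite leNgt; apply/negP => /ball.
    rewrite b00 mul0r arc0; lra.
  have bpos : 0 < b by rewrite lt_neqAle eq_sym bN.
  case: ps sps ps0 {main} ub => [//|p1 ps] [sps] ps0 ub.
  have eta0 : 0 < b / m by rewrite divr_gt0.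
  have mb : m * (b / m) = b by rewrite mulrC.
  have [|w wt werr] := euler_arc_tracking hF (A := Az) (z := z) eta0 ps0.
    rewrite sps -/m mb /Az ler_wpM2l// ler_wpM2l ?addr_ge0 ?enorm_ge0//.
    by rewrite ler_expR ler_wpM2l.
  rewrite sps -/m mb in werr.
  have wb := outside_ball_before (tame_is_trajectory wt) nSz b0 bz ball.
  have eta_e : b / m <= e.
    rewrite ler_pdivrMr//; apply: le_trans bB _.
    have : B * tau <= e * m * tau.
      have k1 := ler_wpM2l (ltW B0) kh_tau.
      have k2 := ler_wpM2l (ltW m0) hT; lra.
    by rewrite ler_pM2r.
  have pow_le : (1 + b / m * K) ^+ k.+1 <= expR (K * B).
    apply: le_trans (exp_bound _ (mulr_ge0 (ltW eta0) K0)) _.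
    by rewrite ler_expR -/m mulrA mb mulrC ler_wpM2l.
  have X0 : 0 <= K * Az by rewrite mulr_ge0.
  have err : m * (K * Az * (b / m) ^+ 2) <= e * (B * (K * Az)).
    have -> : m * (K * Az * (b / m) ^+ 2) = (K * Az) * (b * (b / m)).
      by rewrite -{3}mb; ring.
    have -> : e * (B * (K * Az)) = (K * Az) * (B * e) by ring.
    by rewrite ler_wpM2l// ler_pM// ltW.
  have werr' : enorm (w b - euler_arc F (b / m) (p1 :: ps) z) <=
      e * (expR (K * B) * (B * (K * Az))).
    apply: le_trans werr _.
    have -> : e * (expR (K * B) * (B * (K * Az))) =
      expR (K * B) * (e * (B * (K * Az))) by ring.
    apply: ler_pM => //.
      by rewrite exprn_ge0// addr_ge0// mulr_ge0// ltW.
    by rewrite mulr_ge0 ?(ltW m0)// mulr_ge0 ?sqr_ge0.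
  have tri := enorm_triangle (euler_arc F (b / m) (p1 :: ps) z) (w b) c.
  rewrite lerBlDr; apply: le_trans wb _; apply: le_trans tri _.
  by rewrite addrC lerD2l.
have sq0 : 0 <= sq by rewrite addr_ge0 ?sqr_ge0.
have := ler_wpM2r sq0 curv; lra.
Qed.

End ApproximateNormal.

(** * Exact exterior normals *)

Section MinimumTime.
Context {R : realType} {n : nat}.
Variables (F : 'rV[R]_n -> set 'rV[R]_n) (S O : set 'rV[R]_n).
Hypothesis OC : O `<=` controllable_set F S.

Lemma minimum_time_ge0 z : (0 <= minimum_time F S z)%E.
Proof.
apply: le_ereal_inf_tmp => _ [y _ <-]; apply: le_ereal_inf_tmp => _ [t [t0 _] <-].
by rewrite lee_fin.
Qed.

Lemma minimum_time_fine z : O z ->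
  minimum_time F S z = (fine (minimum_time F S z))%:E.
Proof.
move=> /OC[_ Tz]; rewrite fineK// ge0_fin_numE//; exact: minimum_time_ge0.
Qed.

End MinimumTime.

Section ExactNormal.
Context {R : realType} {n : nat}.
Variable F : 'rV[R]_n -> set 'rV[R]_n.
Variables L c0 K Lam : R.
Hypothesis hF : regular_inclusion F L c0 K Lam.
Variables (S O : set 'rV[R]_n) (rho0 : R).
Hypothesis cS : closed S.
Hypothesis rho00 : 0 < rho0.
Hypothesis inner : inner_ball_property S rho0.
Hypothesis oO : open O.
Hypothesis OC : O `<=` controllable_set F S.
Hypothesis cT : {within O, continuous (minimum_time F S)}.
Local Notation T := (fun x => fine (minimum_time F S x)).

Lemma minimum_time_cvg x : O x -> minimum_time F S @ x --> minimum_time F S x.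
Proof.
move: cT; rewrite continuous_open_subspace// => h Ox.
by apply: h; rewrite inE.
Qed.

Lemma curvature_ge0 M : 0 <= M -> 0 <= curvature L c0 K Lam rho0 M.
Proof.
move=> M0; rewrite mulr_ge0 ?expR_ge0// addr_ge0 ?invr_ge0 ?(ltW rho00)//.
rewrite mulr_ge0 ?expR_ge0// addr_ge0 ?(ri_L0 hF)// mulr_ge0 ?(ri_c0 hF)//.
by rewrite addr_ge0.
Qed.

(** At [theta] below the minimum time, the point [(x, theta)] is interior to the
    hypograph, where no nonzero proximal normal exists; hence the hitting times
    of the discrete optimal arcs converge to the minimum time. *)
Lemma exact_normal M x : O x -> enorm x <= M -> T x <= M ->
  exists p q,
    [/\ adjoint_floor L M <= enorm p <= adjoint_bound L M,
        0 <= q <= speed_bound Lam M * adjoint_bound L M &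
        forall z b, O z -> 0 <= b <= horizon M -> b <= T z ->
          dot p (z - x) + q * (b - T x) <=
            curvature L c0 K Lam rho0 M * (enorm (z - x) ^+ 2 + (b - T x) ^+ 2)].
Proof.
move=> Ox xM TxM; have [nSx _] := OC Ox.
have M0 : 0 <= M := le_trans (enorm_ge0 x) xM.
set T0 := T x in TxM *; set sg := curvature _ _ _ _ _ _.
have sg0 : 0 <= sg by exact: curvature_ge0.
have Tx : minimum_time F S x = T0%:E by exact: minimum_time_fine OC _ Ox.
have [tau tau0 happ] := approximate_normal hF cS rho00 inner nSx Tx xM TxM.
pose e (m : nat) : R := m.+1%:R^-1.
have e0 m : 0 < e m by rewrite invr_gt0.
have e1 m : e m <= 1 by rewrite invf_le1// ler1n.
have ex m : exists u : 'rV[R]_n * R * R,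
    [/\ tau <= u.2 < T0 + e m,
        adjoint_floor L M <= enorm u.1.1 <= adjoint_bound L M,
        `|u.1.2| <= speed_bound Lam M * adjoint_bound L M &
        forall z b, ~ S z -> 0 <= b <= horizon M ->
          (b%:E <= minimum_time F S z)%E ->
          dot u.1.1 (z - x) + u.1.2 * (b - u.2) <=
            sg * (enorm (z - x) ^+ 2 + (b - u.2) ^+ 2) +
            e m * (1 + expR (K * horizon M) * (horizon M *
              (K * (Lam * ((1 + enorm z) * expR (Lam * horizon M))))))].
  by have [p [q [th h]]] := happ (e m) (e0 m) (e1 m); exists (p, q, th).
have [u hu] := boolp.choice ex.
have [U UU sU] := nat_ultrafilter.
have PU : ProperFilter U by exact: ultra_proper.
have FU : Filter U by exact: PU.
have ecvg : e @ U --> (0 : R).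
  apply: cvg_trans (@cvg_harmonic R); exact: cvg_app sU.
have cst (a : R) : (fun=> a) @ U --> a by exact: cvg_cst.
have [p pcvg] : exists p : 'rV[R]_n, (fun m => (u m).1.1) @ U --> p.
  apply/cvg_ex; apply: (@ultra_bounded_cvg _ _ _ _ (adjoint_bound L M)) => m.
  by have [_ /andP[]] := hu m.
have [q qcvg] : exists q : R, (fun m => (u m).1.2) @ U --> q.
  apply/cvg_ex; apply: (@ultra_bounded_cvgR _ _ _
    (speed_bound Lam M * adjoint_bound L M)) => m.
  by have [] := hu m.
have T0tau : 0 <= T0 by rewrite -lee_fin -Tx minimum_time_ge0.
have [th thcvg] : exists th : R, (fun m => (u m).2) @ U --> th.
  apply/cvg_ex; apply: (@ultra_bounded_cvgR _ _ _ (T0 + 1)) => m.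
  have [/andP[h1 h2] _ _ _] := hu m.
  have h3 : 0 <= (u m).2 by apply: le_trans h1; exact: ltW.
  by rewrite ger0_norm// (le_trans (ltW h2))// lerD2l.
have th_tau : tau <= th.
  by apply: (filter_le_cvg (f := fun=> tau) PU (cst tau) thcvg) => m; have [/andP[]] := hu m.
have th0 : 0 < th by exact: lt_le_trans th_tau.
have th_T0 : th <= T0.
  have h1 := @cvgD _ _ _ U FU _ _ _ _ (cst T0) ecvg; rewrite addr0 in h1.
  apply: (filter_le_cvg PU thcvg h1) => m.
  by have [/andP[_ /ltW]] := hu m.
have pb : adjoint_floor L M <= enorm p <= adjoint_bound L M.
  have pn := @enorm_cvg _ _ _ U FU _ _ pcvg.
  apply/andP; split.
    apply: (filter_le_cvg (f := fun=> adjoint_floor L M) PU (cst _) pn) => m.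
    by have [_ /andP[]] := hu m.
  apply: (filter_le_cvg (g := fun=> adjoint_bound L M) PU pn (cst _)) => m.
  by have [_ /andP[]] := hu m.
have q_le : q <= speed_bound Lam M * adjoint_bound L M.
  apply: (filter_le_cvg (g := fun=> speed_bound Lam M * adjoint_bound L M) PU qcvg (cst _)) => m.
  by have [_ _ qm _] := hu m; apply: le_trans (ler_norm _) qm.
have limit_ineq z b : O z -> 0 <= b <= horizon M -> b <= T z ->
    dot p (z - x) + q * (b - th) <= sg * (enorm (z - x) ^+ 2 + (b - th) ^+ 2).
  move=> Oz b0 bT; have [nSz _] := OC Oz.
  have bT' : (b%:E <= minimum_time F S z)%E.
    by rewrite (minimum_time_fine OC Oz) lee_fin.
  set W := 1 + expR (K * horizon M) * (horizon M *
              (K * (Lam * ((1 + enorm z) * expR (Lam * horizon M))))).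
  have zc : (fun=> z - x) @ U --> z - x by exact: cvg_cst.
  have bth := @cvgB _ _ _ U FU _ _ _ _ (cst b) thcvg.
  have lhs := @cvgD _ _ _ U FU _ _ _ _ (@dot_cvg _ _ _ U FU _ _ _ _ pcvg zc)
    (@cvgM _ _ U FU _ _ _ _ qcvg bth).
  have rhs := @cvgD _ _ _ U FU _ _ _ _
    (@cvgM _ _ U FU _ _ _ _ (cst sg) (@cvgD _ _ _ U FU _ _ _ _
      (cst (enorm (z - x) ^+ 2)) (@cvgM _ _ U FU _ _ _ _ bth bth)))
    (@cvgM _ _ U FU _ _ _ _ ecvg (cst W)).
  rewrite mul0r addr0 in rhs.
  apply: (filter_le_cvg PU lhs rhs) => m.
  by have [_ _ _ hm] := hu m; have := hm z b nSz b0 bT'.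
have pfloor : 0 < enorm p.
  by case/andP: pb => h _; apply: lt_le_trans h; rewrite expR_gt0.
have th_eq : th = T0.
  apply/eqP; rewrite eq_le th_T0 leNgt; apply/negP => thT.
  have near1 : \forall z \near x, (th%:E < minimum_time F S z)%E.
    have nb : nbhs (minimum_time F S x) [set w | (th%:E < w)%E].
      by rewrite Tx; apply: open_ereal_gt'; rewrite lte_fin.
    exact: (minimum_time_cvg Ox nb).
  have near2 : \forall z \near x, O z by exact: open_nbhs_nbhs.
  have [d/= d0 hd] := (nbhs_ballP x _).1 (@filterI _ _ (nbhs_filter x) _ _ near1 near2).
  pose s := Num.min (d / (2 * enorm p)) ((2 * (sg + 1))^-1).
  have sg1 : 0 < sg + 1 by rewrite ltr_wpDl.
  have s0 : 0 < s by rewrite lt_min divr_gt0 ?mulr_gt0// invr_gt0 mulr_gt0.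
  have sd : enorm (s *: p) < d.
    rewrite enormZ (gtr0_norm s0).
    have : s * (2 * enorm p) <= d by rewrite -ler_pdivlMr ?mulr_gt0// ge_min lexx.
    have : 0 < s * enorm p by rewrite mulr_gt0.
    lra.
  have [|Tz Oz] := hd (x + s *: p).
    rewrite -ball_normE/= opprD addNKr normrN.
    exact: le_lt_trans (norm_le_enorm _) sd.
  have := limit_ineq (x + s *: p) th Oz.
  rewrite ltW//= (le_trans th_T0) ?(le_trans TxM) ?lerDl// => /(_ isT).
  have -> : th <= T (x + s *: p).
    by rewrite -lee_fin -(minimum_time_fine OC Oz) ltW.
  move=> /(_ isT); rewrite addrAC subrr add0r subrr mulr0 expr0n !addr0.
  rewrite dotZr enormZ (gtr0_norm s0) exprMn -enorm_sqr => h1.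
  have sg_s : sg * s <= 2^-1.
    have : s * (2 * (sg + 1)) <= 1.
      by rewrite -ler_pdivlMr ?mulr_gt0// div1r ge_min lexx orbT.
    by have := s0; lra.
  have pp : 0 < s * enorm p ^+ 2 by rewrite mulr_gt0// exprn_gt0.
  have := ler_wpM2r (ltW pp) sg_s; lra.
rewrite th_eq in limit_ineq th0.
exists p, q; split=> //; rewrite q_le andbT leNgt; apply/negP => q0.
pose s := Num.min T0 (- q / (2 * (sg + 1))).
have sg1 : 0 < sg + 1 by rewrite ltr_wpDl.
have s0 : 0 < s by rewrite lt_min th0 divr_gt0 ?mulr_gt0// oppr_gt0.
have sT : s <= T0 by rewrite ge_min lexx.
have sq : s * (2 * (sg + 1)) <= - q by rewrite -ler_pdivlMr ?mulr_gt0// ge_min lexx orbT.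
have := limit_ineq x (T0 - s) Ox.
have -> : 0 <= T0 - s <= horizon M by rewrite subr_ge0 sT/= /horizon; lra.
rewrite gerBl (ltW s0) subrr dot0r enorm0 expr0n !add0r => /(_ isT isT).
have -> : T0 - s - T0 = - s by ring.
move=> h1; have h2 : 0 <= s * (sg * s + q) by lra.
rewrite pmulr_rge0// in h2; have := mulr_ge0 sg0 (ltW s0); lra.
Qed.

Definition exterior_curvature M :=
  curvature L c0 K Lam rho0 M + (1 + speed_bound Lam M) * adjoint_bound L M.

Definition exterior_radius M := adjoint_floor L M / (2 * exterior_curvature M).

Lemma exterior_curvature_gt0 M : 0 <= M -> 0 < exterior_curvature M.
Proof.
move=> M0; rewrite ltr_wpDl ?curvature_ge0// mulr_gt0 ?expR_gt0//.
have := ri_Lam0 hF => Lam0.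
by rewrite ltr_wpDr// !addr_ge0// !mulr_ge0 ?addr_ge0 ?expR_ge0.
Qed.

Lemma exterior_radius_gt0 M : 0 <= M -> 0 < exterior_radius M.
Proof.
by move=> M0; rewrite divr_gt0 ?expR_gt0// mulr_gt0// exterior_curvature_gt0.
Qed.

(** Far from the point the quadratic right-hand side dominates the linear
    left-hand side; times below [0] reduce to time [0] because [q] is
    nonnegative. *)
Lemma global_normal M x : O x -> enorm x <= M -> T x <= M ->
  exists p q, adjoint_floor L M <= enorm p /\
    forall z b, O z -> b <= T z -> dot p (z - x) + q * (b - T x) <=
      exterior_curvature M * (enorm (z - x) ^+ 2 + (b - T x) ^+ 2).
Proof.
move=> Ox xM TM; have [p [q [/andP[pl pu] /andP[q0 qu] h]]] := exact_normal Ox xM TM.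
have M0 : 0 <= M := le_trans (enorm_ge0 x) xM.
exists p, q; split=> // z b Oz bT.
have T0 : 0 <= T x by rewrite fine_ge0// minimum_time_ge0.
have Tz0 : 0 <= T z by rewrite fine_ge0// minimum_time_ge0.
have sg0 := curvature_ge0 M0.
have P0 : 0 < adjoint_bound L M by rewrite expR_gt0.
have A0 : 0 <= speed_bound Lam M * adjoint_bound L M by exact: le_trans qu.
set sg := curvature _ _ _ _ _ _ in h sg0 *; set AP := _ * adjoint_bound L M in qu A0 *.
set P := adjoint_bound L M in pu P0 *; set E := enorm (z - x).
rewrite (_ : exterior_curvature M = sg + (P + AP)); last first.
  by rewrite /exterior_curvature mulrDl mul1r.
have E0 : 0 <= E ^+ 2 by exact: sqr_ge0.
have extra D : 0 <= D -> sg * D <= (sg + (P + AP)) * D.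
  by move=> D0; rewrite ler_wpM2r// lerDl addr_ge0// ltW.
have [b0|b0] := leP 0 b; last first.
  have := h z 0 Oz; rewrite lexx addr_ge0// => /(_ isT Tz0).
  have q1 : q * (b - T x) <= q * (0 - T x) by rewrite ler_wpM2l// lerB// ltW.
  have D1 : (0 - T x) ^+ 2 <= (b - T x) ^+ 2.
    have Tb : T x <= T x - b by rewrite lerBrDr gerDl ltW.
    rewrite sub0r sqrrN -[leRHS]sqrrN opprB.
    by apply: lerXn2r; rewrite ?nnegrE// (le_trans T0).
  have D2 : 0 <= E ^+ 2 + (b - T x) ^+ 2 by rewrite addr_ge0 ?sqr_ge0.
  move=> h0; apply: le_trans (extra _ D2).
  apply: le_trans (_ : _ <= sg * (E ^+ 2 + (0 - T x) ^+ 2)) _.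
    by apply: le_trans h0; rewrite lerD2l.
  by rewrite ler_wpM2l// lerD2l.
have D2 : 0 <= E ^+ 2 + (b - T x) ^+ 2 by rewrite addr_ge0 ?sqr_ge0.
have [bB|bB] := leP b (horizon M).
  by apply: le_trans (extra _ D2); apply: h => //; rewrite b0.
have s1 : 1 <= b - T x by rewrite lerBrDl (le_trans _ (ltW bB))// lerD2r.
set s := b - T x in s1 D2 *.
have s2 : s <= s ^+ 2 by rewrite expr2 ler_peMl// (le_trans _ s1).
have E1 : E <= E ^+ 2 + s ^+ 2.
  have := sqr_ge0 (E - 1); rewrite sqrrB mulr1 expr1n; lra.
have Es : s <= E ^+ 2 + s ^+ 2 by lra.
have h1 : dot p (z - x) <= P * (E ^+ 2 + s ^+ 2).
  by apply: le_trans (dot_le _ _) _; rewrite ler_pM ?enorm_ge0.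
have h2 : q * s <= AP * (E ^+ 2 + s ^+ 2) by rewrite ler_pM// (le_trans _ s1).
have h3 := mulr_ge0 sg0 D2; lra.
Qed.

Lemma dot_row_mx (a b : 'rV[R]_n) (s t : R) :
  dot (row_mx a s%:M : 'rV[R]_(n + 1)) (row_mx b t%:M) = dot a b + s * t.
Proof.
rewrite /dot tr_row_mx mul_row_col mxE; congr (_ + _).
by rewrite tr_scalar_mx -scalar_mxM mxE eqxx mulr1n.
Qed.

Lemma graph_pointB (a b : 'rV[R]_n) (s t : R) :
  graph_point a s - graph_point b t = row_mx (a - b) (s - t)%:M.
Proof.
rewrite /graph_point opp_row_mx add_row_mx; congr row_mx.
by apply/matrixP => i j; rewrite !mxE mulrnBl.
Qed.

Lemma hypograph_exterior_sphere :
  exterior_sphere O T (fun x => exterior_radius (enorm x + T x)).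
Proof.
move=> x Ox; set M := enorm x + T x.
have T0 : 0 <= T x by rewrite fine_ge0// minimum_time_ge0.
have M0 : 0 <= M by rewrite addr_ge0 ?enorm_ge0.
have [||p [q [pl h]]] := @global_normal M x Ox.
- by rewrite lerDl.
- by rewrite lerDr enorm_ge0.
have ec0 := exterior_curvature_gt0 M0.
have p0 : 0 < enorm p by apply: lt_le_trans pl; rewrite expR_gt0.
pose v : 'rV[R]_(n + 1) := row_mx p q%:M.
have pv : enorm p <= enorm v.
  rewrite -(@ler_pXn2r _ 2)// ?nnegrE ?enorm_ge0// !enorm_sqr dot_row_mx.
  by rewrite lerDl -expr2 sqr_ge0.
have v0 : 0 < enorm v by exact: lt_le_trans pv.
have ball : realized_by_ball (hypo O T) (graph_point x (T x)) v (exterior_radius M).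
  move=> _ [z [b [Oz bT ->]]]; rewrite graph_pointB dot_row_mx enorm_sqr dot_row_mx.
  rewrite -enorm_sqr -expr2; apply: le_trans (h z b Oz bT) _.
  rewrite ler_wpM2r ?addr_ge0 ?sqr_ge0//.
  rewrite /exterior_radius.
  have f0 : 0 < adjoint_floor L M by rewrite expR_gt0.
  have -> : enorm v / (2 * (adjoint_floor L M / (2 * exterior_curvature M))) =
    enorm v / adjoint_floor L M * exterior_curvature M.
    by field; rewrite !gt_eqF.
  rewrite -[leLHS]mul1r ler_pM2r// ler_pdivlMr// mul1r.
  exact: le_trans pv.
exists v; split=> //; first by rewrite -enorm_gt0.
exists (enorm v / (2 * exterior_radius M)); last exact: ball.
by rewrite divr_ge0 ?enorm_ge0// mulr_ge0// ltW// exterior_radius_gt0.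
Qed.

Lemma exterior_radius_continuous x : O x ->
  {for x, continuous (fun x => exterior_radius (enorm x + T x))}.
Proof.
move=> Ox; have T0 : 0 <= T x by rewrite fine_ge0// minimum_time_ge0.
set M := enorm x + T x.
have M0 : 0 <= M by rewrite addr_ge0 ?enorm_ge0.
have FX : Filter (nbhs x) := nbhs_filter x.
have cM : (fun x => enorm x + T x) @ x --> M.
  apply: (@cvgD _ _ _ (nbhs x) FX).
    exact: (@enorm_cvg _ _ _ (nbhs x) FX _ _ cvg_id).
  apply: (@fine_cvg _ _ (nbhs x) FX).
  by rewrite -(minimum_time_fine OC Ox); exact: minimum_time_cvg.
suff cR : exterior_radius @ M --> exterior_radius M by exact: (cvg_comp _ _ cM cR).
have cst (a : R) : (fun=> a) @ M --> a by exact: cvg_cst.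
have exp_c (f : R -> R) : f @ M --> f M -> (fun M => expR (f M)) @ M --> expR (f M).
  by move=> fM; exact: (cvg_comp _ _ fM (@continuous_expR R (f M))).
have cH : (@horizon R) @ M --> horizon M by apply: cvgD; [exact: cvg_id|exact: cst].
have cA : (speed_bound Lam) @ M --> speed_bound Lam M.
  apply: cvgD; last exact: cst.
  apply: cvgM; first exact: cst.
  apply: cvgM; first by apply: cvgD; [exact: cst|exact: cvg_id].
  by apply: exp_c; apply: cvgM; [exact: cst|exact: cH].
have cP : (adjoint_bound L) @ M --> adjoint_bound L M.
  by apply: exp_c; apply: cvgM; [exact: cst|exact: cH].
have cF : (adjoint_floor L) @ M --> adjoint_floor L M.
  by apply: exp_c; apply: cvgN; apply: cvgM; [exact: cst|exact: cH].
have cBK : (fun M => horizon M * K) @ M --> horizon M * K.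
  by apply: cvgM; [exact: cH|exact: cst].
have cG : (fun M => curvature_rate K (horizon M) (speed_bound Lam M)) @ M -->
    curvature_rate K (horizon M) (speed_bound Lam M).
  apply: cvgD; last exact: (cvgM cA cA).
  apply: cvgD; apply: cvgM => //; apply: cvgD => //; exact: cst.
have cC : (curvature L c0 K Lam rho0) @ M --> curvature L c0 K Lam rho0 M.
  apply: cvgM; first exact: (exp_c _ cG).
  apply: cvgD; first exact: cst.
  apply: cvgM => //; apply: cvgD; first exact: cst.
  by apply: cvgM => //; exact: cst.
have cE : exterior_curvature @ M --> exterior_curvature M.
  by apply: cvgD => //; apply: cvgM => //; apply: cvgD => //; exact: cst.
apply: cvgM => //; apply: cvgV; last by apply: cvgM => //; exact: cst.
by rewrite gt_eqF// mulr_gt0// exterior_curvature_gt0.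
Qed.

End ExactNormal.

Theorem theorem4p1 (R : realType) (n : nat)
    (F : 'rV[R]_n -> set 'rV[R]_n) (S : set 'rV[R]_n) (rho0 : R)
    (O : set 'rV[R]_n) :
  F1 F -> F2 F -> H1 F -> H2 F ->
  S !=set0 -> closed S -> 0 < rho0 -> inner_ball_property S rho0 ->
  open O -> O `<=` controllable_set F S ->
  {within O, continuous (minimum_time F S)} ->
  exists rho_T : 'rV[R]_n -> R,
    [/\ {within O, continuous rho_T},
        forall x, O x -> 0 < rho_T x &
        exterior_sphere O (fun x => fine (minimum_time F S x)) rho_T].
Proof.
move=> f1 f2 h1 h2 _ cS rho00 inner oO OC cT.
have [L [c0 [K [Lam hF]]]] := regular_inclusionP f1 f2 h1 h2.
exists (fun x => exterior_radius L c0 K Lam rho0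
  (enorm x + fine (minimum_time F S x))); split.
- apply: continuous_in_subspaceT => x; rewrite inE => Ox.
  exact: (exterior_radius_continuous hF rho00 oO OC cT Ox).
- move=> x Ox; apply: (exterior_radius_gt0 hF rho00).
  by rewrite addr_ge0 ?enorm_ge0// fine_ge0// minimum_time_ge0.
- exact: (hypograph_exterior_sphere hF cS rho00 inner oO OC cT).
Qed.
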